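(* Let $d\ge4$, and let $X=\{V_i\}_{i=1}^N\subset G_{2,d}$ (a set of $N$ distinct planes) be an $\mathrm{ECTFF}_2$, i.e. an equi-chordal equal-weight tight $2$-fusion frame. Then $$\frac{d^2}{4}\le N\le\binom{d+1}{2}.$$ Moreover, equality in the lower bound holds if and only if $X$ is an $\mathrm{EITFF}_2$ on $G_{2,d}$ (an equi-isoclinic equal-weight tight $2$-fusion frame), and equality in the upper bound holds if and only if $X$ is a tight Grassmann $4$-design on $G_{2,d}$.
   Context: $G_{k,d}$ is the set of $k$-dimensional linear subspaces of $\mathbb R^d$, with $O(d)$-invariant probability measure $\sigma_{k,d}$; $P_V$ is the orthogonal projection onto $V$. Principal angles: for $V,W\in G_{k,d}$ let $Q_V,Q_W\in\mathbb R^{d\times k}$ have orthonormal columns spanning $V,W$, and let $\sigma_1\ge\dots\ge\sigma_k\ge0$ be the singular values of $Q_V^{\mathsf T}Q_W$ (they lie in $[0,1]$ and do not depend on the bases). The principal angles are $\theta_i(V,W)=\arccos\sigma_i\in[0,\pi/2]$, $i=1,\dots,k$. The chordal distance is $d_C(V,W)=\sqrt{\sum_{\ell=1}^k\sin^2\theta_\ell(V,W)}$. A finite set $\{V_i\}_{i=1}^N\subset G_{k,d}$ is equi-chordal if $d_C(V_i,V_j)$ is the same constant for all $i\ne j$; it is equi-isoclinic if there is $\theta\in[0,\pi/2]$ such that $\theta_\ell(V_i,V_j)=\theta$ for all $i\ne j$ and all $\ell=1,\dots,k$. Equal-weight tight $t$-fusion frame: a finite set $X\subset G_{k,d}$ such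 that for some $A>0$, $\sum_{V\in X}\|P_Vx\|^{2t}=A\|x\|^{2t}$ for all $x\in\mathbb R^d$. $\mathrm{ECTFF}_t$ (resp. $\mathrm{EITFF}_t$) means an equi-chordal (resp. equi-isoclinic) equal-weight tight $t$-fusion frame. Grassmann designs: $L^2(G_{k,d})$ decomposes without multiplicity into irreducible $O(d)$-representations $\mathsf H^{k,d}_{2\mu}$ of type $2\mu=(2\mu_1,\dots,2\mu_r)$, where $\mu=(\mu_1\ge\dots\ge\mu_r\ge1)$ runs over partitions (including the empty one) with length $\ell(\mu)=r\le k$ (a component is zero if that type does not occur). With $\deg\mu=\sum_i\mu_i$, set $\mathrm{Pol}_{2t}(G_{k,d})=\bigoplus_{\ell(\mu)\le k,\ \deg\mu\le t}\mathsf H^{k,d}_{2\mu}$. A finite set $X\subset G_{k,d}$ is a Grassmann $2t$-design if $\int_{G_{k,d}}f\,d\sigma_{k,d}=\frac1{|X|}\sum_{V\in X}f(V)$ for all $f\in\mathrm{Pol}_{2t}(G_{k,d})$. For $d\ge4$, a tight Grassmann $4$-design is a Grassmann $4$-design $X\subset G_{k,d}$ with $|X|=\binom{d+1}{2}$. *)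

(* Defs.v *)
From HB Require Import structures.
From mathcomp Require Import all_boot all_order all_fingroup all_algebra.
From mathcomp Require Import all_classical all_reals all_analysis.

Set Implicit Arguments.
Unset Strict Implicit.
Unset Printing Implicit Defensive.

Import Order.TTheory GRing.Theory Num.Theory.
Import numFieldNormedType.Exports.

Local Open Scope classical_set_scope.
Local Open Scope ring_scope.

Section Euclidean.
Variables (R : realType) (d : nat).

(* The library norm on 'cV[R]_d is the sup norm, hence a separate definition. *)
Definition enorm (x : 'cV[R]_d) : R := Num.sqrt ((x^T *m x) 0 0).

Definition orthv (V : {vspace 'cV[R]_d}) : {vspace 'cV[R]_d} :=
  (\bigcap_(u <- vbasis V) lker (linfun (mulmx u^T : 'cV[R]_d -> 'M[R]_1)))%VS.

Definition orthproj (V : {vspace 'cV[R]_d}) : 'End('cV[R]_d) :=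
  daddv_pi V (orthv V).

Definition orthproj_mx (V : {vspace 'cV[R]_d}) : 'M[R]_d :=
  \matrix_(i, j) (orthproj V (delta_mx j 0)) i 0.

Definition orthogonal_group := {g : 'M[R]_d | g^T *m g == 1%:M}.

End Euclidean.

Record grass (R : realType) (k d : nat) := Grass {
  gspace :> {vspace 'cV[R]_d};
  dim_gspace : \dim gspace == k }.

HB.instance Definition _ (R : realType) (k d : nat) :=
  [isSub for @gspace R k d].
HB.instance Definition _ (R : realType) (k d : nat) :=
  [Choice of grass R k d by <:].

(* The usual topology of the Grassmannian, through V |-> P_V. *)
HB.instance Definition _ (R : realType) (k d : nat) :=
  Topological.copy (grass R k d)
    (initial_topology (fun V : grass R k d => orthproj_mx V)).

Section Action.
Variables (R : realType) (k d : nat).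

Lemma gact_subproof (g : orthogonal_group R d) (V : grass R k d) :
  \dim (linfun (mulmx (val g) : 'cV[R]_d -> 'cV[R]_d) @: V)%VS == k.
Proof.
case: V => /= V /eqP dV; apply/eqP; rewrite -dV; apply/limg_dim_eq/eqP.
rewrite -subv0; apply/subvP => x /memv_capP[_]; rewrite memv_ker lfunE /=.
move=> /eqP gx0; rewrite memv0 -[x]mul1mx -(eqP (valP g)) -mulmxA.
by rewrite gx0 mulmx0.
Qed.

Definition gact (g : orthogonal_group R d) (V : grass R k d) : grass R k d :=
  Grass (gact_subproof g V).

End Action.

(* The library only has sigma-algebras on inhabited types, so the Borel space
   of the Grassmannian carries a proof of k <= d. *)
Definition pgrass (R : realType) (k d : nat) (kd : (k <= d)%N) := grass R k d.

Lemma grass_point_subproof (R : realType) (k d : nat) (kd : (k <= d)%N) :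
  \dim <<take k (vbasis (fullv : {vspace 'cV[R]_d}))>>%VS == k.
Proof.
have fB := basis_free (vbasisP (fullv : {vspace 'cV[R]_d})).
move: fB; rewrite -{1}(cat_take_drop k (vbasis _)) => /catl_free.
rewrite /free => /eqP ->.
by rewrite size_takel// size_tuple dimvf /dim /= muln1.
Qed.

HB.instance Definition _ (R : realType) (k d : nat) (kd : (k <= d)%N) :=
  Choice.on (pgrass R kd).
HB.instance Definition _ (R : realType) (k d : nat) (kd : (k <= d)%N) :=
  isPointed.Build (pgrass R kd)
    (Grass (grass_point_subproof R kd)).

Definition grass_borel (R : realType) (k d : nat) (kd : (k <= d)%N) :=
  g_sigma_algebraType (@open (grass R k d) : set (set (pgrass R kd))).

(* There is exactly one probability measure with this property. *)
Definition O_invariant (R : realType) (k d : nat) (kd : (k <= d)%N)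
    (sigma : probability (grass_borel R kd) R) : Prop :=
  forall (g : orthogonal_group R d) (A : set (grass_borel R kd)),
    measurable A -> sigma (gact g @^-1` A) = sigma A.

Section PrincipalAngles.
Variables (R : realType) (k d : nat).

Definition orthonormal_basis (Q : 'M[R]_(d, k)) (V : grass R k d) : Prop :=
  Q^T *m Q = 1%:M /\ <<[seq col i Q | i : 'I_k]>>%VS = V.

(* The squares of the singular values are the eigenvalues of M^T M, with
   multiplicity. *)
Definition is_singular_values (M : 'M[R]_k) (s : {ffun 'I_k -> R}) : Prop :=
  [/\ forall i, 0 <= s i,
      forall i j : 'I_k, (i <= j)%N -> s j <= s i
    & char_poly (M^T *m M) = \prod_(i < k) ('X - (s i ^+ 2)%:P)].

(* The set below is a singleton. *)
Definition principal_cosines (V W : grass R k d) : {ffun 'I_k -> R} :=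
  xget [ffun=> 0] [set s | exists QV QW : 'M[R]_(d, k),
    [/\ orthonormal_basis QV V, orthonormal_basis QW W
      & is_singular_values (QV^T *m QW) s]].

Definition principal_angle (V W : grass R k d) (l : 'I_k) : R :=
  acos (principal_cosines V W l).

Definition chordal_dist (V W : grass R k d) : R :=
  Num.sqrt (\sum_(l < k) sin (principal_angle V W l) ^+ 2).

End PrincipalAngles.

Section FusionFrames.
Variables (R : realType) (k d N : nat).

Definition equi_chordal (V : 'I_N -> grass R k d) : Prop :=
  exists c : R, forall i j, i != j -> chordal_dist (V i) (V j) = c.

Definition equi_isoclinic (V : 'I_N -> grass R k d) : Prop :=
  exists2 theta : R, 0 <= theta <= pi / 2 &
    forall i j, i != j -> forall l, principal_angle (V i) (V j) l = theta.

Definition tight_fusion_frame (t : nat) (V : 'I_N -> grass R k d) : Prop :=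
  exists2 A : R, 0 < A & forall x : 'cV[R]_d,
    \sum_(i < N) enorm (orthproj (V i) x) ^+ (2 * t)
      = A * enorm x ^+ (2 * t).

Definition ECTFF (t : nat) (V : 'I_N -> grass R k d) : Prop :=
  equi_chordal V /\ tight_fusion_frame t V.

Definition EITFF (t : nat) (V : 'I_N -> grass R k d) : Prop :=
  equi_isoclinic V /\ tight_fusion_frame t V.

End FusionFrames.

Definition is_partition (mu : seq nat) : bool :=
  sorted geq mu && (0%N \notin mu).

(* Weyl's construction: the irreducible O(d)-representation of type lambda is
   the space of traceless tensors in the image of the Young symmetrizer of
   lambda; it is zero when the first two columns of lambda have total length
   greater than d. *)
Section Weyl.
Variables (R : realType) (d : nat).

Definition tensor (n : nat) := {ffun {ffun 'I_n -> 'I_d} -> R^o}.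

Definition tensor_act n (g : orthogonal_group R d) (T : tensor n) : tensor n :=
  [ffun i : {ffun 'I_n -> 'I_d} =>
    \sum_(j : {ffun 'I_n -> 'I_d}) (\prod_(a < n) val g (i a) (j a)) * T j].

Definition place_perm n (s : 'S_n) (T : tensor n) : tensor n :=
  [ffun i : {ffun 'I_n -> 'I_d} => T [ffun a => i (s a)]].

Definition traceless n (T : tensor n) : Prop :=
  forall a b : 'I_n, a != b -> forall i : {ffun 'I_n -> 'I_d},
    \sum_(c < d) T [ffun x => if (x == a) || (x == b) then c else i x] = 0.

(* The boxes of the diagram of lambda are numbered row by row: box m is in row
   reshape_index lambda m and column reshape_offset lambda m. *)
Definition row_stab (lambda : seq nat) (s : 'S_(sumn lambda)) : bool :=
  [forall m, reshape_index lambda (s m) == reshape_index lambda m].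

Definition col_stab (lambda : seq nat) (s : 'S_(sumn lambda)) : bool :=
  [forall m, reshape_offset lambda (s m) == reshape_offset lambda m].

Definition young_symmetrizer (lambda : seq nat) (T : tensor (sumn lambda)) :
    tensor (sumn lambda) :=
  \sum_(p | row_stab p) \sum_(q | col_stab q)
    (-1) ^+ odd_perm q *: place_perm p (place_perm q T).

Definition weyl_module (lambda : seq nat) : set (tensor (sumn lambda)) :=
  [set T | traceless T /\ exists U, T = young_symmetrizer U].

End Weyl.

Section Designs.
Variables (R : realType) (k d : nat).

(* O(d)-equivariant linear maps from the representation of type lambda to the
   continuous functions on the Grassmannian (the elements of a
   finite-dimensional invariant subspace of L^2 have continuous
   representatives). *)
Definition is_intertwiner (lambda : seq nat)
    (Phi : tensor R d (sumn lambda) -> grass R k d -> R) : Prop :=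
  [/\ forall (a : R) T U, weyl_module T -> weyl_module U ->
        forall V, Phi (a *: T + U) V = a * Phi T V + Phi U V,
      forall (g : orthogonal_group R d) T, weyl_module T ->
        forall V, Phi (tensor_act g T) (gact g V) = Phi T V
    & forall T, weyl_module T -> continuous (Phi T)].

(* The component of type 2 mu; as it has multiplicity at most one, it is the
   image of any nonzero intertwiner, if there is one, and zero otherwise. *)
Definition Hcomp (mu : seq nat) : set (grass R k d -> R) :=
  [set f | exists2 Phi, is_intertwiner Phi &
    exists2 T : tensor R d (sumn [seq (2 * m)%N | m <- mu]),
      weyl_module T & f = Phi T].

(* Pol2 t is Pol_{2t}: the finite sums of elements of the components. *)
Definition Pol2 (t : nat) : set (grass R k d -> R) :=
  [set f | exists (m : nat) (mu : 'I_m -> seq nat)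
      (h : 'I_m -> grass R k d -> R),
    (forall j, [/\ is_partition (mu j), (size (mu j) <= k)%N,
       (sumn (mu j) <= t)%N & Hcomp (mu j) (h j)]) /\
    (forall V, f V = \sum_(j < m) h j V)].

(* Grassmann 2t-designs; V is meant to be injective. *)
Definition grassmann_design2 (kd : (k <= d)%N)
    (sigma : probability (grass_borel R kd) R) (t N : nat)
    (V : 'I_N -> grass R k d) : Prop :=
  forall f, Pol2 t f ->
    (\int[sigma]_(W in [set: grass_borel R kd]) (f W)%:E)%E
      = (N%:R^-1 * \sum_(i < N) f (V i))%:E.

Definition tight_grassmann_4design (kd : (k <= d)%N)
    (sigma : probability (grass_borel R kd) R) (N : nat)
    (V : 'I_N -> grass R k d) : Prop :=
  grassmann_design2 sigma 2 V /\ N = 'C(d.+1, 2).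

End Designs.

Lemma leq2_of_leq4 (d : nat) : (4 <= d)%N -> (2 <= d)%N.
Proof. exact: leq_trans. Qed.

(* Main.v *)
Require Import Defs.
From HB Require Import structures.
From mathcomp Require Import all_boot all_order all_fingroup all_algebra.
From mathcomp Require Import all_classical all_reals all_analysis.
From mathcomp Require Import ring lra zify.
Import Order.TTheory GRing.Theory Num.Theory.
Import numFieldNormedType.Exports.
Local Open Scope ring_scope.
Set Implicit Arguments.
Unset Strict Implicit.
Unset Printing Implicit Defensive.

(** ** Why the bounds hold

Write P_i for the orthogonal projection onto V_i.  For two planes with cosines
a >= b of the principal angles, tr(P_i P_j) = a^2 + b^2 and
tr((P_i P_j)^2) = a^4 + b^4, so the squared chordal distance is
2 - tr(P_i P_j): the planes are equi-chordal exactly when tr(P_i P_j) = s is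
constant for i <> j.

Polarising the quartic identity that defines a tight 2-fusion frame
([tight_frame_polar]) and summing it over orthonormal families
([tight_frame_trace]) evaluates A, shows that the P_i sum to a multiple of the
identity, and gives
sum_i (tr(P_i P_j)^2 + 2 tr((P_i P_j)^2)) = 8A for every j.
Together they express the sum over i <> j of
2 tr((P_i P_j)^2) - s^2 = (a^2 - b^2)^2 as a positive multiple of
N(d - 2)(4N - d^2) ([slack_identity]).  This is the lower bound, with equality
iff a = b for all pairs, i.e. iff the frame is equi-isoclinic.

The Gram matrix (2 - s) I + s J of the P_i, together with tr P_i = 2, makes
them linearly independent in the space of symmetric matrices, whose dimension
is binomial(d + 1, 2): this is the upper bound.

In the extremal case the P_i are a basis of the symmetric matrices, on which
Y |-> sum_i tr(P_i Y) P_i is determined by its values at the P_j.  It is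
Y |-> (2 - s) Y + const * tr(Y) I, so the second moment
sum_i P_i (x) P_i is a combination of the three pairings
delta delta ([frame_second_moment]).  The second moment of an invariant
probability has the same shape ([moment2_isotropic]).  It remains to see that a
function f = Phi T, for an equivariant Phi and a traceless tensor T of order
2 or 4, is a combination of contractions of T with P_V or with
P_V (x) P_V ([intertwiner2], [intertwiner4]); then both the integral and the
average of f are contractions of T with Kronecker deltas, hence zero.  To see
it, fix a plane V0 and represent T |-> Phi T V0 by a tensor L in the
representation (Riesz).  By uniqueness L is fixed by the stabiliser
O(2) x O(d - 2) of V0, and its entries are computed from the invariance under
reflections in coordinate planes ([isotropic2], [isotropic4]): L is a sum of
products of Kronecker deltas whose coefficients depend only on which indices
are smaller than 2.  Tracelessness of T removes every coefficient but one for
each pairing. *)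

(** * Orthonormal bases *)

Lemma memv_orthv (R : realType) d (V : {vspace 'cV[R]_d}) (x : 'cV[R]_d) :
  reflect (forall u, u \in V -> u^T *m x = 0) (x \in orthv V).
Proof.
have cap_seq (s : seq 'cV[R]_d) : reflect (forall u, u \in s -> u^T *m x = 0)
  (x \in \bigcap_(u <- s) lker (linfun (mulmx u^T : 'cV[R]_d -> 'M[R]_1)))%VS.
  elim: s => [|u s IH]; first by rewrite big_nil memvf; apply: ReflectT.
  rewrite big_cons memv_cap memv_ker lfunE /=; apply: (iffP andP).
    by move=> [/eqP ux /IH h] v; rewrite in_cons => /predU1P[->//|/h].
  move=> h; split; first by rewrite h ?mem_head.
  by apply/IH => v vs; rewrite h// in_cons vs orbT.
apply: (iffP (cap_seq _)) => h u uV; last by apply: h; exact: vbasis_mem.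
rewrite (coord_vbasis uV) linear_sum mulmx_suml big1 // => i _.
by rewrite linearZ /= -scalemxAl h ?scaler0 // mem_nth // size_tuple.
Qed.

Lemma mulmx_tr_eq0 (R : realType) d (x : 'cV[R]_d) :
  ((x^T *m x) 0 0 == 0) = (x == 0).
Proof.
rewrite mxE; apply/idP/eqP => [|->]; last first.
  by apply/eqP; rewrite big1 // => i _; rewrite !mxE mul0r.
rewrite psumr_eq0 => [/allP h|i _]; last by rewrite !mxE -expr2 sqr_ge0.
apply/matrixP => i j; rewrite !mxE ord1.
by have := h i (mem_index_enum _); rewrite !mxE -expr2 /= sqrf_eq0 => /eqP.
Qed.

Lemma mulmx_tr_ge0 (R : realType) d (x : 'cV[R]_d) : 0 <= (x^T *m x) 0 0.
Proof. by rewrite mxE sumr_ge0 // => i _; rewrite !mxE -expr2 sqr_ge0. Qed.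

Lemma enorm_sqr (R : realType) d (x : 'cV[R]_d) :
  enorm x ^+ 2 = (x^T *m x) 0 0.
Proof. by rewrite sqr_sqrtr ?mulmx_tr_ge0. Qed.

Lemma capv_orthv (R : realType) d (V : {vspace 'cV[R]_d}) :
  (V :&: orthv V = 0)%VS.
Proof.
apply/eqP; rewrite -subv0; apply/subvP => x /memv_capP[xV /memv_orthv/(_ _ xV)].
by move=> xx; rewrite memv0 -mulmx_tr_eq0 xx mxE.
Qed.

(** The induction splits off a unit vector u of V and continues in the orthogonal
    complement of u inside V. *)
Lemma exists_orthonormal (R : realType) d k (V : {vspace 'cV[R]_d}) :
  \dim V = k -> exists Q : 'M[R]_(d, k), Q^T *m Q = 1%:M /\
    forall x, x \in V <-> exists y, x = Q *m y.
Proof.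
elim: k V => [|k IH] V dV.
  exists 0; split; first by apply/matrixP => - [].
  move=> x; move/eqP: dV; rewrite dimv_eq0 => /eqP ->; rewrite memv0; split.
    by move=> /eqP->; exists 0; rewrite mulmx0.
  by move=> [y ->]; rewrite mul0mx.
pose v := vpick V.
have vV : v \in V by exact: memv_pick.
have v0 : v != 0 by rewrite vpick0 -dimv_eq0 dV.
have nv : 0 < (v^T *m v) 0 0 by rewrite lt0r mulmx_tr_eq0 v0 mulmx_tr_ge0.
pose u := (Num.sqrt ((v^T *m v) 0 0))^-1 *: v.
have uu : u^T *m u = 1%:M.
  apply/matrixP => i j; rewrite !ord1 -scalemxAr linearZ /= -scalemxAl scalerA.
  rewrite mxE [RHS]mxE /= -expr2 exprVn sqr_sqrtr ?(ltW nv) // mulVf //.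
  exact: lt0r_neq0.
have uV : u \in V by exact: memvZ.
have u0 : u != 0 by rewrite -mulmx_tr_eq0 uu mxE oner_eq0.
pose V' := (V :&: orthv <[u]>)%VS.
have memV' x : x \in V' <-> x \in V /\ u^T *m x = 0.
  split=> [/memv_capP[xV /memv_orthv h]|[xV ux]].
    by split=> //; apply: h; exact: memv_line.
  apply/memv_capP; split=> //; apply/memv_orthv => w /vlineP[a ->].
  by rewrite linearZ /= -scalemxAl ux scaler0.
have decV x : x \in V -> x - u *m (u^T *m x) \in V'.
  move=> xV; apply/memV'; split; last by rewrite mulmxBr !mulmxA uu mul1mx subrr.
  rewrite rpredB //; have -> : u^T *m x = ((u^T *m x) 0 0)%:M.
    by rewrite [LHS]mx11_scalar.
  by rewrite mul_mx_scalar memvZ.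
have dV' : \dim V' = k.
  have -> : V' = (V :&: orthv <[u]>)%VS by [].
  have cap0 : (<[u]> :&: V' = 0)%VS.
    apply/eqP; rewrite -subv0; apply/subvP => x /memv_capP[xu /memv_capP[_ xo]].
    by rewrite -(capv_orthv <[u]>); apply/memv_capP.
  have : \dim (<[u]> + V') = k.+1.
    rewrite -dV; congr (\dim _); apply/eqP; rewrite eqEsubv subv_add.
    rewrite -memvE uV capvSl /=; apply/subvP => x xV.
    have -> : x = u *m (u^T *m x) + (x - u *m (u^T *m x)) by rewrite addrC subrK.
    apply: memv_add (decV _ xV).
    by rewrite [u^T *m x]mx11_scalar mul_mx_scalar memvZ // memv_line.
  by rewrite dimv_disjoint_sum // dim_vline u0 => -[].
have [Q [QQ memQ]] := IH _ dV'.
have uQ : u^T *m Q = 0.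
  apply/matrixP => i j; rewrite mxE.
  have /memV'[_] : Q *m delta_mx j 0 \in V' by apply/memQ; exists (delta_mx j 0).
  by move/matrixP/(_ i 0); rewrite mulmxA -colE !mxE.
have Qu : Q^T *m u = 0 by rewrite -[LHS]trmxK trmx_mul trmxK uQ trmx0.
have QQ1 : (row_mx u Q)^T *m row_mx u Q = 1%:M.
  by rewrite tr_row_mx mul_col_row uu uQ QQ Qu -scalar_mx_block.
exists (row_mx u Q : 'M[R]_(d, (1 + k)%N)); split; first exact: QQ1.
move=> x; split=> [xV|[y ->]].
  have /memQ[y Qy] := decV _ xV; exists (col_mx (u^T *m x) y).
  by rewrite (mul_row_col u Q (u^T *m x) y) -Qy addrC subrK.
have -> : row_mx u Q *m y =
    u *m usubmx (y : 'cV[R]_(1 + k)%N) + Q *m dsubmx (y : 'cV[R]_(1 + k)%N).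
  by rewrite -mul_row_col vsubmxK.
rewrite rpredD //.
  by rewrite [usubmx _]mx11_scalar mul_mx_scalar memvZ.
have /memV'[] // : Q *m dsubmx (y : 'cV[R]_(1 + k)%N) \in V'.
by apply/memQ; eexists.
Qed.

(** * Orthogonal projections and the action of the orthogonal group *)

Lemma span_colsP (R : realType) d k (Q : 'M[R]_(d, k)) (x : 'cV[R]_d) :
  x \in <<[seq col i Q | i : 'I_k]>>%VS <-> exists y, x = Q *m y.
Proof.
have mulQ y : Q *m y = \sum_i y i 0 *: col i Q :> 'cV_d.
  apply/matrixP => i j; rewrite ord1 mxE summxE; apply: eq_bigr => l _.
  by rewrite !mxE mulrC.
split=> [|[y ->]]; last first.
  rewrite mulQ rpred_sum // => i _; apply/memvZ/memv_span/map_f.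
  exact: mem_enum.
pose f := linfun (mulmx Q : 'cV[R]_k -> 'cV[R]_d).
suff /subvP sub : (<<[seq col i Q | i : 'I_k]>> <= limg f)%VS.
  by move=> /sub /memv_imgP[y _ ->]; exists y; rewrite lfunE.
apply/span_subvP => _ /mapP[i _ ->]; apply/memv_imgP.
by exists (delta_mx i 0); rewrite ?memvf // lfunE /= colE.
Qed.

Lemma orthonormal_basisP (R : realType) k d (Q : 'M[R]_(d, k)) (V : grass R k d) :
  orthonormal_basis Q V <->
  Q^T *m Q = 1%:M /\ forall x, x \in gspace V <-> exists y, x = Q *m y.
Proof.
split=> -[QQ h]; split=> //.
  by move=> x; rewrite -h; exact: span_colsP.
by apply/vspaceP => x; apply/idP/idP; [move/span_colsP/h|move/h/span_colsP].
Qed.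

Lemma exists_orthonormal_basis (R : realType) k d (V : grass R k d) :
  exists Q, orthonormal_basis Q V.
Proof.
have [Q hQ] := exists_orthonormal (eqP (dim_gspace V)).
by exists Q; apply/orthonormal_basisP.
Qed.

Lemma exists_grass (R : realType) k d (Q : 'M[R]_(d, k)) :
  Q^T *m Q = 1%:M -> exists V : grass R k d, orthonormal_basis Q V.
Proof.
move=> QQ; pose f := linfun (mulmx Q : 'cV[R]_k -> 'cV[R]_d).
have inj_f : lker f = 0%VS.
  apply/eqP; rewrite -subv0; apply/subvP => x.
  rewrite memv_ker memv0 lfunE /= => /eqP Qx.
  by rewrite -[x]mul1mx -QQ -mulmxA Qx mulmx0.
have dimf : \dim (limg f) == k.
  by rewrite limg_dim_eq ?inj_f ?capv0 // dimvf /dim /= muln1.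
exists (Grass dimf); apply/orthonormal_basisP; split=> // x /=.
split=> [/memv_imgP[y _ ->]|[y ->]]; first by exists y; rewrite lfunE.
by apply/memv_imgP; exists y; rewrite ?memvf ?lfunE.
Qed.

Lemma residual_orthv (R : realType) k d (V : grass R k d) (Q : 'M[R]_(d, k)) x :
  orthonormal_basis Q V -> x - Q *m Q^T *m x \in orthv V.
Proof.
move=> /orthonormal_basisP[QQ memQ].
apply/memv_orthv => u /memQ[z ->]; rewrite trmx_mul mulmxBr !mulmxA.
by rewrite -[_ *m Q^T *m Q]mulmxA QQ mulmx1 subrr.
Qed.

(** Both sides decompose x along V and its orthogonal complement, and such a
    decomposition is unique. *)
Lemma orthproj_basis (R : realType) k d (V : grass R k d) (Q : 'M[R]_(d, k)) x :
  orthonormal_basis Q V -> orthproj V x = Q *m Q^T *m x.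
Proof.
move=> hQ; have in_orth y := residual_orthv y hQ.
move/orthonormal_basisP: (hQ) => [QQ memQ].
have in_V y : Q *m Q^T *m y \in gspace V.
  by apply/memQ; exists (Q^T *m y); rewrite mulmxA.
have xsum : x \in (gspace V + orthv V)%VS.
  have -> : x = Q *m Q^T *m x + (x - Q *m Q^T *m x) by rewrite addrC subrK.
  exact: memv_add.
have add := daddv_pi_add (capv_orthv V) xsum.
apply/eqP; rewrite -subr_eq0; rewrite -memv0 -(capv_orthv V).
apply/memv_capP; split; first by rewrite rpredB // memv_pi.
have -> : orthproj V x - Q *m Q^T *m x =
    (x - Q *m Q^T *m x) - (x - orthproj V x).
  by rewrite opprB [RHS]addrC addrA subrK.
by rewrite rpredB // -{1}add addrC addKr memv_pi.
Qed.

Lemma orthproj_mx_basis (R : realType) k d (V : grass R k d) (Q : 'M[R]_(d, k)) :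
  orthonormal_basis Q V -> orthproj_mx V = Q *m Q^T.
Proof.
move=> hQ; apply/matrixP => i j.
by rewrite mxE (orthproj_basis _ hQ) -colE mxE.
Qed.

Section OrthProj.
Variables (R : realType) (k d : nat).
Implicit Types V W : grass R k d.

Lemma orthprojE V x : orthproj V x = orthproj_mx V *m x.
Proof.
have [Q hQ] := exists_orthonormal_basis V.
by rewrite (orthproj_basis _ hQ) (orthproj_mx_basis hQ).
Qed.

Lemma orthproj_mx_sym V : (orthproj_mx V)^T = orthproj_mx V.
Proof.
have [Q hQ] := exists_orthonormal_basis V.
by rewrite (orthproj_mx_basis hQ) trmx_mul trmxK.
Qed.

Lemma orthproj_mx_idem V : orthproj_mx V *m orthproj_mx V = orthproj_mx V.
Proof.
have [Q hQ] := exists_orthonormal_basis V.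
rewrite (orthproj_mx_basis hQ) mulmxA -[_ *m Q]mulmxA.
by case: hQ => -> _; rewrite mulmx1.
Qed.

Lemma mxtrace_orthproj_mx V : \tr (orthproj_mx V) = k%:R.
Proof.
have [Q hQ] := exists_orthonormal_basis V.
by rewrite (orthproj_mx_basis hQ) mxtrace_mulC; case: hQ => -> _; rewrite mxtrace1.
Qed.

Lemma mem_orthproj_mx V x : (x \in gspace V) = (orthproj_mx V *m x == x).
Proof.
have [Q hQ] := exists_orthonormal_basis V.
rewrite (orthproj_mx_basis hQ); move/orthonormal_basisP: hQ => [QQ memQ].
apply/idP/eqP => [/memQ[y ->]|<-].
  by rewrite mulmxA -[_ *m Q]mulmxA QQ mulmx1.
by apply/memQ; exists (Q^T *m x); rewrite mulmxA.
Qed.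

Lemma orthproj_mx_inj : injective (fun V => orthproj_mx V).
Proof.
move=> V W PVW; apply/val_inj/vspaceP => x /=.
by rewrite !mem_orthproj_mx PVW.
Qed.

Lemma orthproj_mx_gact (g : orthogonal_group R d) V :
  orthproj_mx (Defs.gact g V) = val g *m orthproj_mx V *m (val g)^T.
Proof.
have [Q hQ] := exists_orthonormal_basis V.
have /eqP gg : (val g)^T *m val g == 1%:M by case: g.
have hgQ : orthonormal_basis (val g *m Q) (Defs.gact g V).
  apply/orthonormal_basisP; move/orthonormal_basisP: hQ => [QQ memQ]; split.
    by rewrite trmx_mul mulmxA -[_ *m val g]mulmxA gg mulmx1.
  move=> x; split=> [/memv_imgP[y /memQ[z ->] ->]|[y ->]].
    by exists z; rewrite lfunE /= mulmxA.
  apply/memv_imgP; exists (Q *m y); last by rewrite lfunE /= mulmxA.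
  by apply/memQ; exists y.
by rewrite (orthproj_mx_basis hgQ) (orthproj_mx_basis hQ) trmx_mul !mulmxA.
Qed.

Lemma orthonormal_completion V Q : orthonormal_basis Q V ->
  exists Q' : 'M[R]_(d, d - k), Q'^T *m Q' = 1%:M /\ Q *m Q^T + Q' *m Q'^T = 1%:M.
Proof.
move=> hQ; have resid x := residual_orthv x hQ.
move/orthonormal_basisP: hQ => [QQ memQ].
have dimo : \dim (orthv V) = (d - k)%N.
  have full : (gspace V + orthv V = fullv)%VS.
    apply/eqP; rewrite eqEsubv subvf; apply/subvP => x _.
    have -> : x = Q *m Q^T *m x + (x - Q *m Q^T *m x) by rewrite addrC subrK.
    apply: memv_add; first by apply/memQ; exists (Q^T *m x); rewrite mulmxA.
    exact: resid.
  have := dimv_disjoint_sum (capv_orthv V).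
  rewrite full (eqP (dim_gspace V)) dimvf /dim /= muln1 => dE.
  by apply/eqP; rewrite -(eqn_add2l k) -dE subnKC // dE leq_addr.
have [Q' [QQ' memQ']] := exists_orthonormal dimo.
exists Q'; split=> //.
have Q'Q : Q'^T *m Q = 0.
  apply/matrixP => i j; rewrite [RHS]mxE.
  have /memv_orthv o : Q' *m delta_mx i 0 \in orthv V.
    by apply/memQ'; exists (delta_mx i 0).
  have : (Q' *m delta_mx i 0)^T *m (Q *m delta_mx j 0) = 0 :> 'M[R]_1.
    rewrite -[LHS]trmxK trmx_mul trmxK o ?trmx0 //.
    by apply/memQ; exists (delta_mx j 0).
  rewrite trmx_mul trmx_delta mulmxA -[_ *m Q'^T *m Q]mulmxA -rowE -colE.
  by move/matrixP/(_ 0 0); rewrite !mxE.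
suff h (x : 'cV[R]_d) : (Q *m Q^T + Q' *m Q'^T) *m x = x.
  by apply/matrixP => i j; have /matrixP/(_ i 0) := h (delta_mx j 0); rewrite -colE !mxE andbT.
have /memQ'[y xy] := resid x; have yE : y = Q'^T *m x.
  by rewrite -[y]mul1mx -QQ' -mulmxA -xy mulmxBr !mulmxA Q'Q !mul0mx subr0.
by rewrite mulmxDl -[Q' *m _ *m _]mulmxA -yE -xy addrC subrK.
Qed.

(** If [Q | Q'] and [S | S'] are orthogonal matrices whose first k columns span V
    and W, then S Q^T + S' Q'^T carries V to W.  Writing it as a sum of two
    products avoids block matrices of size k + (d - k). *)
Lemma gact_transitive V W : exists g, W = Defs.gact g V.
Proof.
have [Q hQ] := exists_orthonormal_basis V.
have [S hS] := exists_orthonormal_basis W.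
have [Q' [QQ' Q1]] := orthonormal_completion hQ.
have [S' [SS' S1]] := orthonormal_completion hS.
have EQ := orthproj_mx_basis hQ; have ES := orthproj_mx_basis hS.
have QQ := proj1 hQ; have SS := proj1 hS.
have orth0 (m n : nat) (A : 'M[R]_(d, m)) (B : 'M[R]_(d, n)) :
    A^T *m A = 1%:M -> B^T *m B = 1%:M -> A *m A^T + B *m B^T = 1%:M ->
    A^T *m B = 0.
  move=> AA BB AB.
  have : (A^T *m B) *m (B^T *m B) = 0.
    rewrite mulmxA -[_ *m B *m B^T]mulmxA; have -> : B *m B^T = 1%:M - A *m A^T.
      by rewrite -AB addrC addKr.
    by rewrite mulmxBr mulmxA AA mulmx1 mul1mx subrr mul0mx.
  by rewrite BB mulmx1.
have S0 := orth0 _ _ _ _ SS SS' S1.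
have S0' : S'^T *m S = 0 by rewrite -[LHS]trmxK trmx_mul trmxK S0 trmx0.
have Q0 := orth0 _ _ _ _ QQ QQ' Q1.
have Q0' : Q'^T *m Q = 0 by rewrite -[LHS]trmxK trmx_mul trmxK Q0 trmx0.
pose g := S *m Q^T + S' *m Q'^T.
have gg : g^T *m g == 1%:M.
  have gT : g^T = Q *m S^T + Q' *m S'^T.
    by rewrite /g linearD /= !trmx_mul !trmxK.
  apply/eqP; rewrite gT /g mulmxDl !mulmxDr !mulmxA.
  rewrite -[Q *m S^T *m S]mulmxA -[Q' *m S'^T *m S']mulmxA.
  rewrite -[Q *m S^T *m S']mulmxA -[Q' *m S'^T *m S]mulmxA.
  by rewrite SS SS' S0 S0' !mulmx0 !mul0mx !mulmx1 addr0 add0r.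
exists (exist _ g gg : orthogonal_group R d); apply: orthproj_mx_inj.
rewrite orthproj_mx_gact /= EQ ES.
have gQ : g *m Q = S.
  by rewrite mulmxDl -!mulmxA QQ Q0' mulmx0 mulmx1 addr0.
by rewrite mulmxA gQ -mulmxA -trmx_mul gQ.
Qed.

End OrthProj.

(** * Principal angles between two planes *)

Lemma char_poly_mx2 (R : realType) (S : 'M[R]_2) :
  char_poly S = 'X^2 - (\tr S)%:P * 'X + (\det S)%:P.
Proof.
apply/polyP => i; rewrite !coefD coefN coefCM coefXn coefX coefC.
case: i => [|[|[|i]]] /=.
- by rewrite char_poly_det expr2 mulN1r opprK mul1r mulr0 subr0 add0r.
- by rewrite (char_poly_trace S (isT : 0 < 2)%N) mulr1 add0r addr0.
- have /monicP := char_poly_monic S; rewrite lead_coefE size_char_poly /= => ->.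
  by rewrite mulr0 subr0 addr0.
by rewrite nth_default ?size_char_poly // mulr0 subr0 addr0.
Qed.

Lemma mxtrace_sqr_mx2 (R : realType) (S : 'M[R]_2) :
  \tr (S *m S) = (\tr S) ^+ 2 - 2 * \det S.
Proof.
rewrite (expand_det_row S 0) /mxtrace !big_ord_recl !big_ord0.
rewrite /cofactor !det_mx11 !mxE !big_ord_recl !big_ord0.
have -> : lift 0 0 = 1 :> 'I_2 by apply/val_inj.
have -> : lift 1 0 = 0 :> 'I_2 by apply/val_inj.
by rewrite /=; ring.
Qed.

(** The discriminant of the characteristic polynomial is a sum of two squares. *)
Lemma disc_sym_mx2 (R : realType) (S : 'M[R]_2) :
  S^T = S -> 0 <= (\tr S) ^+ 2 - 4 * \det S.
Proof.
move=> /matrixP/(_ 0 1); rewrite mxE => S_sym.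
have -> : (\tr S) ^+ 2 - 4 * \det S = (S 0 0 - S 1 1) ^+ 2 + 4 * (S 0 1) ^+ 2.
  rewrite (expand_det_row S 0) /mxtrace !big_ord_recl !big_ord0.
  rewrite /cofactor !det_mx11 !mxE.
  have -> : lift 0 0 = 1 :> 'I_2 by apply/val_inj.
  have -> : lift 1 0 = 0 :> 'I_2 by apply/val_inj.
  by rewrite /= S_sym; ring.
by rewrite addr_ge0 ?sqr_ge0 // mulr_ge0 ?sqr_ge0 // ler0n.
Qed.

Lemma mulmx_proj_le (R : realType) (d : nat) (P : 'M[R]_d) (x : 'cV[R]_d) :
  P^T = P -> P *m P = P -> (x^T *m P *m x) 0 0 <= (x^T *m x) 0 0.
Proof.
move=> PT PP; rewrite -subr_ge0.
have := mulmx_tr_ge0 (x - P *m x).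
rewrite [(_ - _)^T]linearB /= trmx_mul PT mulmxBl !mulmxBr !mulmxA.
rewrite -[x^T *m P *m P]mulmxA PP subrr subr0.
by rewrite !mxE.
Qed.

Section PrincipalCosines.
Variables (R : realType) (d : nat).
Implicit Types (V W : grass R 2 d).

(** A compression of a projection has norm at most one, so the squared singular
    values of Q_V^T Q_W lie in [0, 1]. *)
Lemma gram_eigenvalue k (V W : grass R k d) (QV QW : 'M[R]_(d, k)) a :
  orthonormal_basis QV V -> orthonormal_basis QW W ->
  root (char_poly ((QV^T *m QW)^T *m (QV^T *m QW))) a -> 0 <= a <= 1.
Proof.
move=> hV hW; rewrite -eigenvalue_root_char => /eigenvalueP[v vS v0].
set M := QV^T *m QW in vS; pose x := v^T.
have x0 : 0 < (x^T *m x) 0 0.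
  by rewrite lt0r mulmx_tr_ge0 mulmx_tr_eq0 andbT -(inj_eq (@trmx_inj _ _ _)) trmxK trmx0.
have aE : a * (x^T *m x) 0 0 = ((M *m x)^T *m (M *m x)) 0 0.
  rewrite trmx_mul mulmxA -[x^T *m M^T *m M]mulmxA trmxK vS -scalemxAl.
  by rewrite [RHS]mxE.
have Mx : ((M *m x)^T *m (M *m x)) 0 0 <= (x^T *m x) 0 0.
  have -> : x^T *m x = (QW *m x)^T *m (QW *m x).
    by rewrite trmx_mul mulmxA -[x^T *m QW^T *m QW]mulmxA (proj1 hW) mulmx1.
  have -> : (M *m x)^T *m (M *m x) = (QW *m x)^T *m orthproj_mx V *m (QW *m x).
    by rewrite (orthproj_mx_basis hV) /M !trmx_mul !trmxK !mulmxA.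
  exact: mulmx_proj_le (orthproj_mx_sym V) (orthproj_mx_idem V).
apply/andP; split.
  by rewrite -(pmulr_lge0 _ x0) aE mulmx_tr_ge0.
by rewrite -(ler_pM2r x0) mul1r aE.
Qed.

(** The eigenvalues of a symmetric matrix of size two are given by the quadratic
    formula, and the eigenvalues of a Gram matrix are nonnegative. *)
Lemma exists_principal_cosines V W : exists s, exists QV QW : 'M[R]_(d, 2),
  [/\ orthonormal_basis QV V, orthonormal_basis QW W
    & is_singular_values (QV^T *m QW) s].
Proof.
have [QV hV] := exists_orthonormal_basis V.
have [QW hW] := exists_orthonormal_basis W.
set M := QV^T *m QW; set S := M^T *m M.
pose D := (\tr S) ^+ 2 - 4 * \det S.
have D0 : 0 <= D.
  by apply: disc_sym_mx2; rewrite trmx_mul trmxK.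
pose r := Num.sqrt D; pose a := (\tr S + r) / 2; pose b := (\tr S - r) / 2.
have rr : r ^+ 2 = D by rewrite sqr_sqrtr.
have r0 : 0 <= r by exact: sqrtr_ge0.
have pS : char_poly S = ('X - a%:P) * ('X - b%:P).
  rewrite char_poly_mx2.
  have -> : \tr S = a + b by rewrite /a /b; field.
  have -> : \det S = a * b.
    apply: (@mulfI _ 4); first by rewrite pnatr_eq0.
    have -> : 4 * (a * b) = (\tr S) ^+ 2 - r ^+ 2 by rewrite /a /b; field.
    by rewrite rr /D opprB addrCA subrr addr0.
  by move: a b => a' b'; rewrite polyCD polyCM; ring.
have /andP[a0 _] : 0 <= a <= 1.
  by apply: (gram_eigenvalue hV hW); rewrite -/M -/S pS rootM root_XsubC eqxx.
have /andP[b0 _] : 0 <= b <= 1.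
  by apply: (gram_eigenvalue hV hW); rewrite -/M -/S pS rootM !root_XsubC eqxx orbT.
have ba : b <= a by rewrite /a /b; lra.
exists [ffun i : 'I_2 => if i == 0 then Num.sqrt a else Num.sqrt b], QV, QW.
split=> //; split.
- by move=> i; rewrite ffunE; case: ifP; rewrite sqrtr_ge0.
- move=> i j ij; rewrite !ffunE; case: eqP => [j0|_]; case: eqP => [i0|/eqP i0] //.
  + by move: ij i0; rewrite j0 leqn0 => /eqP i0; case/eqP; apply/val_inj.
  + exact: ler_wsqrtr.
by rewrite !big_ord_recl big_ord0 !ffunE /= !sqr_sqrtr // mulr1 -/S pS.
Qed.

(** Everything that is needed about principal angles: they enter the argument
    only through the traces of the first two powers of P_V P_W. *)
Lemma principal_cosinesP V W : exists a b : R,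
  [/\ principal_cosines V W 0 = a, principal_cosines V W 1 = b,
      0 <= b <= a, a <= 1 &
      a ^+ 2 + b ^+ 2 = \tr (orthproj_mx V *m orthproj_mx W) /\
      a ^+ 4 + b ^+ 4 = \tr (orthproj_mx V *m orthproj_mx W *m
                              (orthproj_mx V *m orthproj_mx W))].
Proof.
have [QV [QW [hV hW]]] := xgetPex [ffun=> 0] (exists_principal_cosines V W).
rewrite /is_singular_values -/(principal_cosines V W).
set s := principal_cosines V W; set S := (_ *m _)^T *m _ => -[s0 s10 pS].
have s_le1 i : s i <= 1.
  have /andP[_] : 0 <= s i ^+ 2 <= 1.
    apply: (gram_eigenvalue hV hW); rewrite -/S pS.
    by rewrite (bigD1 i) //= rootM root_XsubC eqxx.
  by rewrite -[X in _ <= X -> _](expr1n _ 2) ler_sqr ?nnegrE ?s0.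
have trS : \tr S = s 0 ^+ 2 + s 1 ^+ 2 /\ \det S = s 0 ^+ 2 * s 1 ^+ 2.
  move: pS; rewrite char_poly_mx2 !big_ord_recl big_ord0 mulr1.
  have -> : lift 0 0 = 1 :> 'I_2 by apply/val_inj.
  move=> pS.
  have e0 := congr1 (fun p : {poly R} => p.[0]) pS.
  have e1 := congr1 (fun p : {poly R} => p.[1]) pS.
  rewrite !hornerE in e0; rewrite !hornerE in e1.
  by split; lra.
have PPE : \tr S = \tr (orthproj_mx V *m orthproj_mx W).
  rewrite (orthproj_mx_basis hV) (orthproj_mx_basis hW) /S trmx_mul trmxK.
  by rewrite mulmxA [RHS]mxtrace_mulC !mulmxA [LHS]mxtrace_mulC !mulmxA.
have PPPPE : \tr (S *m S) = \tr (orthproj_mx V *m orthproj_mx W *m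
                              (orthproj_mx V *m orthproj_mx W)).
  rewrite (orthproj_mx_basis hV) (orthproj_mx_basis hW) /S trmx_mul trmxK.
  by rewrite !mulmxA [RHS]mxtrace_mulC !mulmxA.
exists (s 0), (s 1); split=> //.
  by rewrite s0 s10.
by split; [rewrite -PPE|rewrite -PPPPE mxtrace_sqr_mx2]; case: trS => -> ?; lra.
Qed.

Lemma chordal_dist_sqr V W :
  chordal_dist V W ^+ 2 = 2 - \tr (orthproj_mx V *m orthproj_mx W).
Proof.
rewrite sqr_sqrtr; last by rewrite sumr_ge0 // => i _; rewrite sqr_ge0.
rewrite !big_ord_recl big_ord0 addr0.
have -> : lift 0 0 = 1 :> 'I_2 by apply/val_inj.
have [a [b [Ea Eb /andP[b0 ba] a1 [<- _]]]] := principal_cosinesP V W.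
rewrite /principal_angle Ea Eb !sin2cos2 !acosK ?in_itv /=; first by ring.
  by apply/andP; split; lra.
by apply/andP; split; lra.
Qed.

End PrincipalCosines.

(** * Polarisation of the tight frame identity *)

Section TightFrames.
Variables (R : realType) (d : nat).

Lemma formE m n (B : 'M[R]_(d, m)) (P : 'M[R]_d) (C : 'M[R]_(d, n)) a e :
  ((col a B)^T *m P *m col e C) 0 0 = (B^T *m P *m C) a e.
Proof. by rewrite tr_col [col e C]colE mulmxA -!row_mul -colE [LHS]mxE [LHS]mxE. Qed.

Lemma sym_form (P : 'M[R]_d) (x y : 'cV[R]_d) : P^T = P ->
  (x^T *m P *m y) 0 0 = (y^T *m P *m x) 0 0.
Proof.
move=> PT; have -> : x^T *m P *m y = (y^T *m P *m x)^T.
  by rewrite !trmx_mul trmxK PT mulmxA.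
by rewrite mxE.
Qed.

Lemma form_polar (P : 'M[R]_d) (x y : 'cV[R]_d) (c : R) : P^T = P ->
  ((x + c *: y)^T *m P *m (x + c *: y)) 0 0 =
  (x^T *m P *m x) 0 0 + 2 * c * (x^T *m P *m y) 0 0
    + c ^+ 2 * (y^T *m P *m y) 0 0.
Proof.
move=> PT.
have -> : (x + c *: y)^T *m P *m (x + c *: y) =
    x^T *m P *m x + c *: (x^T *m P *m y) + c *: (y^T *m P *m x)
    + c ^+ 2 *: (y^T *m P *m y).
  rewrite [(x + _)^T]linearD /= [(c *: y)^T]linearZ /= !mulmxDl !mulmxDr.
  by rewrite -!scalemxAl -!scalemxAr scalerA expr2 !addrA.
have coefD (A B : 'M[R]_1) : (A + B) 0 0 = A 0 0 + B 0 0 by rewrite mxE.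
have coefZ a (A : 'M[R]_1) : (a *: A) 0 0 = a * A 0 0 by rewrite mxE.
by rewrite !coefD !coefZ [(y^T *m P *m x) 0 0]sym_form //; ring.
Qed.

Lemma sym_form_eq0 (P : 'M[R]_d) : P^T = P ->
  (forall x : 'cV[R]_d, (x^T *m P *m x) 0 0 = 0) -> P = 0.
Proof.
move=> PT Px0; apply/matrixP => i j; rewrite [RHS]mxE.
have := form_polar (delta_mx i 0) (delta_mx j 0) 1 PT.
rewrite !Px0 => h.
suff -> : P i j = ((delta_mx i 0 : 'cV[R]_d)^T *m P *m (delta_mx j 0 : 'cV[R]_d)) 0 0 by lra.
by rewrite trmx_delta -rowE -colE !mxE.
Qed.

Variables (N k : nat) (V : 'I_N -> grass R k d).
Let P i := orthproj_mx (V i).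

Lemma enorm_orthproj (W : grass R k d) x :
  enorm (orthproj W x) ^+ 2 = (x^T *m orthproj_mx W *m x) 0 0.
Proof.
rewrite enorm_sqr orthprojE trmx_mul orthproj_mx_sym mulmxA.
by rewrite -[x^T *m _ *m orthproj_mx _]mulmxA orthproj_mx_idem.
Qed.

(** Apply the quartic identity to x + y and to x - y: half the sum of the two
    values, less the terms of degree four in x or y alone, is twice the
    polarised form. *)
Lemma tight_frame_polar (A : R) :
  (forall x : 'cV[R]_d, \sum_(i < N) enorm (orthproj (V i) x) ^+ (2 * 2)
      = A * enorm x ^+ (2 * 2)) ->
  forall x y : 'cV[R]_d,
  \sum_(i < N) ((x^T *m P i *m x) 0 0 * (y^T *m P i *m y) 0 0
     + 2 * (x^T *m P i *m y) 0 0 ^+ 2)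
  = A * ((x^T *m 1%:M *m x) 0 0 * (y^T *m 1%:M *m y) 0 0
     + 2 * (x^T *m 1%:M *m y) 0 0 ^+ 2).
Proof.
move=> tight x y.
have quart (z : 'cV[R]_d) : \sum_(i < N) (z^T *m P i *m z) 0 0 ^+ 2
    = A * (z^T *m 1%:M *m z) 0 0 ^+ 2.
  have := tight z; rewrite exprM enorm_sqr mulmx1 => <-.
  by apply: eq_bigr => i _; rewrite exprM enorm_orthproj.
have := quart (x + 1 *: y); have := quart (x + (-1) *: y).
have := quart x; have := quart y.
rewrite !form_polar ?trmx1 //.
under [in X in _ -> _ -> X = _ -> _]eq_bigr => i _.
  rewrite form_polar; last exact: orthproj_mx_sym.
  over.
under [in X in _ -> _ -> _ -> X = _ -> _]eq_bigr => i _.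
  rewrite form_polar; last exact: orthproj_mx_sym.
  over.
move=> qy qx qm qp.
have sum4 : \sum_(i < N) ((x^T *m P i *m x) 0 0 * (y^T *m P i *m y) 0 0
     + 2 * (x^T *m P i *m y) 0 0 ^+ 2) * 4 =
  \sum_(i < N) ((x^T *m P i *m x) 0 0 + 2 * 1 * (x^T *m P i *m y) 0 0
     + 1 ^+ 2 * (y^T *m P i *m y) 0 0) ^+ 2
  + \sum_(i < N) ((x^T *m P i *m x) 0 0 + 2 * (- 1) * (x^T *m P i *m y) 0 0
     + (- 1) ^+ 2 * (y^T *m P i *m y) 0 0) ^+ 2
  - 2 * \sum_(i < N) (x^T *m P i *m x) 0 0 ^+ 2
  - 2 * \sum_(i < N) (y^T *m P i *m y) 0 0 ^+ 2.
  rewrite !mulr_sumr -big_split /= -!sumrB; apply: eq_bigr => i _.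
  by ring.
rewrite qp qm qx qy -mulr_suml in sum4.
by apply: (@mulIf _ 4); rewrite ?pnatr_eq0 // sum4; ring.
Qed.

(** Summing the polarised identity over the columns of B and C turns it into an
    identity between traces against the positive semidefinite matrices
    E = B B^T and F = C C^T.  It is used with B, C equal to the identity, to a
    single vector, or to an orthonormal basis of one of the planes. *)
Lemma tight_frame_trace (A : R) :
  (forall x : 'cV[R]_d, \sum_(i < N) enorm (orthproj (V i) x) ^+ (2 * 2)
      = A * enorm x ^+ (2 * 2)) ->
  forall m n (B : 'M[R]_(d, m)) (C : 'M[R]_(d, n)),
  let E := B *m B^T in let F := C *m C^T in
  \sum_(i < N) (\tr (P i *m E) * \tr (P i *m F) + 2 * \tr (P i *m E *m (P i *m F)))
  = A * (\tr E * \tr F + 2 * \tr (E *m F)).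
Proof.
move=> tight m n B C E F.
have traceE (S : 'M[R]_d) l (D : 'M[R]_(d, l)) : \tr (S *m (D *m D^T)) =
    \sum_c ((col c D)^T *m S *m col c D) 0 0.
  rewrite mulmxA mxtrace_mulC mulmxA; apply: eq_bigr => c _.
  by rewrite formE.
have trace2E (S : 'M[R]_d) : S^T = S -> \tr (S *m E *m (S *m F)) =
    \sum_c \sum_e ((col c B)^T *m S *m col e C) 0 0 ^+ 2.
  move=> ST; have -> : \tr (S *m E *m (S *m F)) =
      \tr (B^T *m S *m C *m (B^T *m S *m C)^T).
    rewrite !trmx_mul trmxK ST /E /F !mulmxA.
    rewrite -[S *m B *m B^T *m S *m C *m C^T]mulmxA.
    rewrite -[S *m B *m B^T *m S *m _]mulmxA -[S *m B *m B^T *m _]mulmxA.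
    by rewrite mxtrace_mulC !mulmxA.
  apply: eq_bigr => c _; rewrite mxE; apply: eq_bigr => e _.
  by rewrite formE [(_^T) e c]mxE expr2.
have EF : \tr (E *m F) = \tr (1%:M *m E *m (1%:M *m F)) by rewrite !mul1mx.
have -> : \tr E = \tr (1%:M *m (B *m B^T)) by rewrite mul1mx.
have -> : \tr F = \tr (1%:M *m (C *m C^T)) by rewrite mul1mx.
rewrite EF trace2E ?trmx1 // !traceE.
transitivity (\sum_(i < N) \sum_c \sum_e
   (((col c B)^T *m P i *m col c B) 0 0 * ((col e C)^T *m P i *m col e C) 0 0
     + 2 * ((col c B)^T *m P i *m col e C) 0 0 ^+ 2)).
  apply: eq_bigr => i _; rewrite /E /F !traceE -/E -/F trace2E ?orthproj_mx_sym //.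
  rewrite big_distrlr /= mulr_sumr -big_split /=; apply: eq_bigr => c _.
  by rewrite mulr_sumr -big_split.
rewrite exchange_big /= big_distrlr /= mulr_sumr -big_split /= mulr_sumr.
apply: eq_bigr => c _; rewrite exchange_big /= mulr_sumr -big_split /= mulr_sumr.
by apply: eq_bigr => e _; rewrite (tight_frame_polar tight).
Qed.

End TightFrames.

(** * The lower bound *)

Section PlaneFrames.
Variables (R : realType) (d N : nat) (V : 'I_N -> grass R 2 d).
Local Notation P i := (orthproj_mx (V i)).
Local Notation tr2 i j := (\tr (P i *m P j)).
Local Notation tr4 i j := (\tr (P i *m P j *m (P i *m P j))).

Lemma tr2_diag i : tr2 i i = 2.
Proof. by rewrite orthproj_mx_idem mxtrace_orthproj_mx. Qed.

Lemma tr4_diag i : tr4 i i = 2.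
Proof. by rewrite !orthproj_mx_idem mxtrace_orthproj_mx. Qed.

(** 4 - 2 tr(P_i P_j) is the squared Hilbert-Schmidt norm of P_i - P_j. *)
Lemma tr2_lt2 i j : injective V -> i != j -> tr2 i j < 2.
Proof.
move=> V_inj ij; have PP : (P i - P j)^T = P i - P j.
  by rewrite [(_ - _)^T]linearB /= !orthproj_mx_sym.
have trPP : \tr ((P i - P j) *m (P i - P j)) = 4 - 2 * tr2 i j.
  rewrite mulmxBl !mulmxBr !linearB /= !tr2_diag [tr2 j i]mxtrace_mulC.
  by ring.
suff : 0 < \tr ((P i - P j) *m (P i - P j)) by rewrite trPP; lra.
have sumE : \tr ((P i - P j) *m (P i - P j)) =
    \sum_a \sum_b (P i - P j) a b ^+ 2.
  rewrite -{1}PP mxtrace_mulC; apply: eq_bigr => a _; rewrite mxE.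
  by apply: eq_bigr => b _; rewrite [(_^T) b a]mxE expr2.
have row_ge0 a : 0 <= \sum_b (P i - P j) a b ^+ 2.
  by apply: sumr_ge0 => b _; exact: sqr_ge0.
rewrite sumE lt0r sumr_ge0 ?andbT //.
apply: contra ij => /eqP /psumr_eq0P h; apply/eqP/V_inj/orthproj_mx_inj.
apply/eqP; rewrite -subr_eq0; apply/eqP/matrixP => a b; rewrite [RHS]mxE.
have /psumr_eq0P /(_ b isT) : \sum_b (P i - P j) a b ^+ 2 = 0 by exact: h.
by move=> /(_ (fun c _ => sqr_ge0 _)) /eqP; rewrite sqrf_eq0 => /eqP.
Qed.

Variables (A s : R).
Hypothesis tight : forall x : 'cV[R]_d,
  \sum_(i < N) enorm (orthproj (V i) x) ^+ (2 * 2) = A * enorm x ^+ (2 * 2).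
Hypothesis equichordal : forall i j, i != j -> tr2 i j = s.

Lemma frame_constant : 8 * N%:R = A * (d%:R * (d%:R + 2)).
Proof.
have := tight_frame_trace tight (1%:M : 'M[R]_d) (1%:M : 'M[R]_d).
rewrite /= trmx1 !mulmx1 mxtrace1.
under eq_bigr do rewrite !mulmx1 tr2_diag mxtrace_orthproj_mx.
by rewrite sumr_const card_ord -mulr_natl => h; lra.
Qed.

(** Take B = 1 and C = x: the two terms agree because P_i is idempotent, and the
    quadratic form of the sum of the P_i comes out proportional to |x|^2. *)
Lemma frame_sum : \sum_i P i = (A * (d%:R + 2) / 4) *: 1%:M.
Proof.
apply/eqP; rewrite -subr_eq0; apply/eqP/sym_form_eq0.
  rewrite [(_ - _)^T]linearB /= [(_ *: _)^T]linearZ /= trmx1; congr (_ - _).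
  by rewrite [LHS]linear_sum /=; apply: eq_bigr => i _; rewrite orthproj_mx_sym.
move=> x; have := tight_frame_trace tight (1%:M : 'M[R]_d) x.
rewrite /= trmx1 !mulmx1 mxtrace1 mul1mx.
have trx (S : 'M[R]_d) : \tr (S *m (x *m x^T)) = (x^T *m S *m x) 0 0.
  by rewrite mulmxA mxtrace_mulC mulmxA /mxtrace big_ord_recl big_ord0 addr0.
under eq_bigr.
  move=> i _; rewrite !mulmx1 mxtrace_orthproj_mx.
  rewrite [P i *m (P i *m _)]mulmxA orthproj_mx_idem trx.
  over.
have coefB (B C : 'M[R]_1) : (B - C) 0 0 = B 0 0 - C 0 0 by rewrite !mxE.
have coefZ a (B : 'M[R]_1) : (a *: B) 0 0 = a * B 0 0 by rewrite mxE.
rewrite mulmxBr mulmxBl coefB -scalemxAr -scalemxAl coefZ mulmx1.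
have -> : \tr (x *m x^T) = (x^T *m x) 0 0.
  by rewrite mxtrace_mulC /mxtrace big_ord_recl big_ord0 addr0.
have -> : (x^T *m (\sum_i P i) *m x) 0 0 = \sum_i (x^T *m P i *m x) 0 0.
  by rewrite mulmx_sumr mulmx_suml summxE.
by rewrite big_split -mulr_sumr /= => h; lra.
Qed.

Lemma frame_tr2 j : \sum_i tr2 i j = A * (d%:R + 2) / 2.
Proof.
rewrite -[LHS](linear_sum (mxtrace : 'M[R]_d -> R)) -mulmx_suml frame_sum.
by rewrite -scalemxAl mul1mx linearZ /= mxtrace_orthproj_mx; lra.
Qed.

(** Here both B and C are an orthonormal basis of V_j. *)
Lemma frame_tr4 j : \sum_i (tr2 i j ^+ 2 + 2 * tr4 i j) = 8 * A.
Proof.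
have [Q hQ] := exists_orthonormal_basis (V j).
have := tight_frame_trace tight Q Q; rewrite /= -(orthproj_mx_basis hQ).
by rewrite tr2_diag mxtrace_orthproj_mx -expr2 => ->; lra.
Qed.

Lemma sum_others (j : 'I_N) (c : R) : \sum_(i | i != j) c = (N%:R - 1) * c.
Proof.
rewrite sumr_const cardC1 card_ord -[LHS]mulr_natl; congr (_ * _).
by case: N j => [[]//|n _]; rewrite /= -[n.+1]addn1 natrD addrK.
Qed.

Lemma frame_angle (j : 'I_N) : 2 + (N%:R - 1) * s = A * (d%:R + 2) / 2.
Proof.
rewrite -(frame_tr2 j) (bigD1 j) //= tr2_diag -(sum_others j); congr (_ + _).
by apply: eq_bigr => i ij; rewrite equichordal.
Qed.

Lemma sum_slack j :
  \sum_(i | i != j) (2 * tr4 i j - s ^+ 2) = 8 * A - 8 - 2 * (N%:R - 1) * s ^+ 2.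
Proof.
have := frame_tr4 j; rewrite (bigD1 j) //= tr2_diag tr4_diag.
have -> : \sum_(i | i != j) (tr2 i j ^+ 2 + 2 * tr4 i j) =
    \sum_(i | i != j) (2 * tr4 i j - s ^+ 2) + \sum_(i | i != j) (2 * s ^+ 2).
  by rewrite -big_split /=; apply: eq_bigr => i ij; rewrite equichordal //; ring.
by rewrite sum_others => h; lra.
Qed.

(** Eliminating A and s leaves a polynomial identity in N and d.  It is multiplied
    by N - 1 rather than divided by it, since N > 1 is only known as a
    consequence of the lower bound. *)
Lemma slack_identity j : (d > 0)%N ->
  (N%:R - 1) * (d%:R ^+ 2 * (d%:R + 2)) *
    \sum_(i | i != j) (2 * tr4 i j - s ^+ 2)
  = 8 * N%:R * (d%:R - 2) * (4 * N%:R - d%:R ^+ 2) :> R.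
Proof.
move=> d0; rewrite sum_slack.
have dR : (0 : R) < d%:R by rewrite ltr0n.
have := frame_constant; have := frame_angle j.
move: (N%:R : R) (d%:R : R) dR => n x x0 ang cst.
have x2 : x + 2 != 0 by lra.
have AE : A = 8 * n / (x * (x + 2)) by rewrite cst; field; lra.
have sE : (n - 1) * s = 4 * n / x - 2.
  have -> : (n - 1) * s = A * (x + 2) / 2 - 2 by lra.
  by rewrite AE; field; lra.
have -> : (n - 1) * (x ^+ 2 * (x + 2)) * (8 * A - 8 - 2 * (n - 1) * s ^+ 2) =
   (x ^+ 2 * (x + 2)) * ((n - 1) * (8 * A - 8) - 2 * ((n - 1) * s) ^+ 2) by ring.
by rewrite sE AE; field; lra.
Qed.

(** The slack of the pair (i, j) vanishes iff its two principal angles agree. *)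
Lemma slackE i j : i != j -> exists a b : R,
  [/\ principal_cosines (V i) (V j) 0 = a, principal_cosines (V i) (V j) 1 = b,
      0 <= b <= a, a <= 1 &
      a ^+ 2 + b ^+ 2 = s /\ 2 * tr4 i j - s ^+ 2 = (a ^+ 2 - b ^+ 2) ^+ 2].
Proof.
move=> ij; have [a [b [Ea Eb ba a1 [E2 E4]]]] := principal_cosinesP (V i) (V j).
exists a, b; split=> //; split; first by rewrite E2 equichordal.
by rewrite -E4 -(equichordal ij) -E2; ring.
Qed.

Lemma slack_ge0 i j : i != j -> 0 <= 2 * tr4 i j - s ^+ 2.
Proof. by move=> /slackE[a [b [_ _ _ _ [_ ->]]]]; exact: sqr_ge0. Qed.

Hypotheses (A_gt0 : 0 < A) (d_ge4 : (4 <= d)%N).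

Lemma dim_ge4 : 4 <= d%:R :> R.
Proof. by rewrite (ler_nat _ 4). Qed.

Lemma frame_nonempty : (0 < N)%N.
Proof.
have x4 := dim_ge4.
rewrite -(ltr0n R); suff : 0 < 8 * N%:R :> R by lra.
by rewrite frame_constant !mulr_gt0 //; lra.
Qed.

Lemma frame_lower_bound : d%:R ^+ 2 / 4 <= N%:R :> R.
Proof.
have x4 := dim_ge4.
have N0 : 0 < N%:R :> R by rewrite ltr0n frame_nonempty.
have N1 : 1 <= N%:R :> R by rewrite ler1n frame_nonempty.
have := slack_identity (Ordinal frame_nonempty) (leq_trans (isT : 0 < 4)%N d_ge4).
set S := \sum_(i | _) _ => h.
have S0 : 0 <= S by apply: sumr_ge0 => i; exact: slack_ge0.
have : 0 <= 8 * N%:R * (d%:R - 2) * (4 * N%:R - d%:R ^+ 2) :> R.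
  by rewrite -h !mulr_ge0 // ?subr_ge0 // ?sqr_ge0 //; lra.
rewrite pmulr_rge0; first by lra.
by rewrite !mulr_gt0 //; lra.
Qed.

Lemma frame_size_ge4 : 4 <= N%:R :> R.
Proof.
have x4 := dim_ge4.
apply: le_trans frame_lower_bound.
have : 4 * 4 <= d%:R * d%:R :> R by rewrite ler_pM //; lra.
by rewrite expr2; lra.
Qed.

(** A sum of nonnegative slacks vanishes iff each of them does. *)
Lemma frame_lower_eq : N%:R = d%:R ^+ 2 / 4 :> R <->
  forall i j, i != j ->
    principal_cosines (V i) (V j) 0 = principal_cosines (V i) (V j) 1.
Proof.
have x4 := dim_ge4.
have N4 := frame_size_ge4.
have id j := slack_identity j (leq_trans (isT : 0 < 4)%N d_ge4).
have cst : 0 < (N%:R - 1) * (d%:R ^+ 2 * (d%:R + 2)) :> R.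
  by rewrite !mulr_gt0 ?exprn_gt0 //; lra.
split=> [NE i j ij|iso].
  have S0 : \sum_(i | i != j) (2 * tr4 i j - s ^+ 2) = 0.
    apply/eqP; have /eqP := id j; rewrite [in X in _ == X]NE.
    rewrite [4 * _]mulrC divfK ?pnatr_eq0 // subrr mulr0 mulf_eq0.
    by rewrite (gt_eqF cst).
  have := psumr_eq0P (fun i => @slack_ge0 i j) S0 ij.
  have [a [b [-> -> /andP[b0 ba] a1 [_ ->]]]] := slackE ij.
  move/eqP; rewrite sqrf_eq0 subr_eq0 eqrXn2 //; first by move/eqP.
  exact: le_trans ba.
have := id (Ordinal frame_nonempty); rewrite big1 => [|i ij].
  have pos : 0 < 8 * N%:R * (d%:R - 2) :> R by rewrite !mulr_gt0 //; lra.
  rewrite mulr0 => /esym/eqP; rewrite mulf_eq0 (gt_eqF pos) subr_eq0 => /eqP.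
  by move=> h; lra.
have [a [b [Ea Eb _ _ [_ ->]]]] := slackE ij.
by rewrite -Ea -Eb iso // subrr expr2 mulr0.
Qed.

End PlaneFrames.

(** * The upper bound and the extremal second moment *)

(** The symmetric matrices are spanned by the E_ab + E_ba with a <= b; these are
    indexed by the sorted pairs, which number binomial(d + 1, 2). *)
Lemma dim_sym_mx (R : realType) d : exists U : {vspace 'M[R]_d},
  (\dim U <= 'C(d.+1, 2))%N /\ forall Y : 'M[R]_d, Y^T = Y -> Y \in U.
Proof.
case: d => [|d].
  by exists 0%VS; rewrite dimv0; split=> // Y _; rewrite memv0; apply/eqP/matrixP => - [].
pose T := [set t : 2.-tuple 'I_d.+1 | sorted leq [seq val i | i <- t]].
pose f (a b : 'I_d.+1) : 'M[R]_d.+1 := delta_mx a b + delta_mx b a.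
pose g (t : 2.-tuple 'I_d.+1) := f (tnth t 0) (tnth t 1).
exists <<[seq g t | t in T]>>%VS; split.
  apply: leq_trans (dim_span _) _; rewrite size_map -cardE card_sorted_tuples.
  by rewrite add2n.
set U := <<_>>%VS => Y YT.
have fU a b : f a b \in U.
  wlog ab : a b / (a <= b)%N => [hw|].
    have [|/ltnW] := leqP a b; first exact: hw.
    by rewrite /f addrC; exact: hw.
  apply: memv_span; apply/mapP; exists [tuple a; b]; last by rewrite /g !(tnth_nth a).
  by rewrite mem_enum inE /= ab.
have -> : Y = 2^-1 *: \sum_a \sum_b Y a b *: f a b.
  have sw : \sum_a \sum_b Y a b *: delta_mx b a = Y.
    rewrite exchange_big [RHS]matrix_sum_delta; apply: eq_bigr => a _.
    by apply: eq_bigr => b _; rewrite -{1}YT mxE.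
  have -> : \sum_a \sum_b Y a b *: f a b = Y + Y.
    transitivity (\sum_a \sum_b Y a b *: delta_mx a b +
                  \sum_a \sum_b Y a b *: delta_mx b a); last first.
      by rewrite sw -matrix_sum_delta.
    rewrite -big_split; apply: eq_bigr => a _ /=.
    by rewrite -big_split; apply: eq_bigr => b _; rewrite scalerDr.
  by rewrite -mulr2n -[Y *+ 2]scaler_nat scalerA mulVf ?pnatr_eq0 // scale1r.
apply/memvZ/rpred_sum => a _; apply: rpred_sum => b _; exact: memvZ.
Qed.

Section PlaneFrameOperator.
Variables (R : realType) (d N : nat) (V : 'I_N -> grass R 2 d).
Local Notation P i := (orthproj_mx (V i)).
Variables (m s : R).
Hypothesis equichordal : forall i j, i != j -> \tr (P i *m P j) = s.
Hypothesis s_lt2 : s < 2.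

Lemma mxtrace_equichordal_comb (c : 'I_N -> R) j :
  \tr ((\sum_i c i *: P i) *m P j) = (2 - s) * c j + s * \sum_i c i.
Proof.
rewrite mulmx_suml linear_sum /= (bigD1 j) //= [\sum_i c i](bigD1 j) //=.
have -> : \sum_(i | i != j) \tr ((c i *: P i) *m P j) = s * \sum_(i | i != j) c i.
  rewrite mulr_sumr; apply: eq_bigr => i ij.
  by rewrite -scalemxAl linearZ /= equichordal // mulrC.
by rewrite -scalemxAl linearZ /= tr2_diag; ring.
Qed.

(** The trace of a vanishing combination shows that its coefficients sum to zero;
    pairing it with P_j then leaves (2 - s) c_j = 0. *)
Lemma equichordal_free : free [tuple P i | i < N].
Proof.
apply/freeP => c; have nthE (i : 'I_N) : [tuple P i | i < N]`_i = P i.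
  by rewrite -tnth_nth tnth_mktuple.
under eq_bigr do rewrite nthE.
move=> c0 j; have /esym := mxtrace_equichordal_comb c j.
have : \tr (\sum_i c i *: P i) = 2 * \sum_i c i.
  rewrite linear_sum mulr_sumr; apply: eq_bigr => i _.
  by rewrite linearZ /= mxtrace_orthproj_mx mulrC.
rewrite c0 mul0mx linear0 => h.
have -> : \sum_i c i = 0 by lra.
rewrite mulr0 addr0 => /eqP; rewrite mulf_eq0 gt_eqF ?subr_gt0 //=.
by move/eqP.
Qed.

Lemma equichordal_upper_bound : (N <= 'C(d.+1, 2))%N.
Proof.
have [U [dimU symU]] := dim_sym_mx R d; apply: leq_trans dimU.
have /eqP <- : \dim <<[tuple P i | i < N]>> == N.
  by have := equichordal_free; rewrite /free size_tuple.
apply: dimvS; apply/span_subvP => _ /mapP[i _ ->].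
by apply: symU; rewrite orthproj_mx_sym.
Qed.

Lemma equichordal_basis : N = 'C(d.+1, 2) ->
  forall Y : 'M[R]_d, Y^T = Y -> exists c : 'I_N -> R, Y = \sum_i c i *: P i.
Proof.
move=> NE Y YT; have [U [dimU symU]] := dim_sym_mx R d.
have dimX : \dim <<[tuple P i | i < N]>> = N.
  by apply/eqP; have := equichordal_free; rewrite /free size_tuple.
have /eqP XU : <<[tuple P i | i < N]>>%VS == U.
  rewrite eqEdim dimX [X in (_ <= X)%N]NE dimU andbT; apply/span_subvP => _ /mapP[i _ ->].
  by apply: symU; rewrite orthproj_mx_sym.
have := symU _ YT; rewrite -XU => /coord_span ->.
exists (fun i => coord [tuple P i | i < N] i Y).
by apply: eq_bigr => i _; rewrite -tnth_nth tnth_mktuple.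
Qed.

Hypothesis frame_op : \sum_i P i = m *: 1%:M.
Hypothesis maximal : N = 'C(d.+1, 2).

(** Both sides are linear in Y and agree at each P_j, and the P_j span the
    symmetric matrices. *)
Lemma frame_operator_sym (Y : 'M[R]_d) : Y^T = Y ->
  \sum_i \tr (P i *m Y) *: P i = (2 - s) *: Y + (s * m / 2 * \tr Y) *: 1%:M.
Proof.
move=> YT; have [c ->] := equichordal_basis maximal YT.
have trc : \tr (\sum_i c i *: P i) = 2 * \sum_i c i.
  rewrite linear_sum mulr_sumr; apply: eq_bigr => i _.
  by rewrite linearZ /= mxtrace_orthproj_mx mulrC.
rewrite trc.
have -> : \sum_i \tr (P i *m (\sum_i c i *: P i)) *: P i =
    \sum_i ((2 - s) *: (c i *: P i) + (s * \sum_i c i) *: P i).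
  apply: eq_bigr => i _; rewrite mxtrace_mulC mxtrace_equichordal_comb.
  by rewrite scalerDl scalerA.
rewrite big_split /= -scaler_sumr -[X in _ + X]scaler_sumr frame_op scalerA.
by congr (_ + _ *: _); field.
Qed.

(** The entry (c, e) of the previous identity at Y = E_ab + E_ba. *)
Lemma frame_second_moment a b c e :
  \sum_i P i a b * P i c e =
    s * m / 2 * (a == b)%:R * (c == e)%:R
    + (2 - s) / 2 * ((a == c)%:R * (b == e)%:R + (a == e)%:R * (b == c)%:R).
Proof.
have YT : (delta_mx a b + delta_mx b a)^T = delta_mx a b + delta_mx b a :> 'M[R]_d.
  by rewrite [LHS]linearD /= !trmx_delta addrC.
have trY (S : 'M[R]_d) : S^T = S ->
    \tr (S *m (delta_mx a b + delta_mx b a)) = 2 * S a b.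
  move=> ST; have trD x y : \tr (S *m delta_mx x y) = S y x.
    rewrite mxtrace_mulC -(mul_delta_mx (0 : 'I_1)) -mulmxA mxtrace_mulC -mulmxA -colE -rowE.
    by rewrite /mxtrace big_ord_recl big_ord0 addr0 !mxE.
  by rewrite mulmxDr linearD /= !trD -{1}ST mxE; ring.
have := frame_operator_sym YT => /matrixP/(_ c e).
rewrite summxE; under eq_bigr do rewrite trY ?orthproj_mx_sym // mxE -mulrA.
rewrite -mulr_sumr -[delta_mx a b + _]mul1mx trY ?trmx1 // mul1mx !mxE.
rewrite [c == a]eq_sym [e == b]eq_sym [c == b]eq_sym [e == a]eq_sym.
rewrite -!mulnb !natrM => h.
apply: (@mulfI _ 2); first by rewrite pnatr_eq0.
by rewrite h; field.
Qed.

End PlaneFrameOperator.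

(** * Tensors fixed by coordinate reflections *)

Section CoordinateReflections.
Variables (R : realType) (d : nat).
Implicit Types (g : 'M[R]_d) (F : 'I_d -> R) (i j k l a b : 'I_d).

(** Action of a matrix on one slot of a tensor; the actions on tensors of order
    two and four nest it, so that a sparse matrix can be evaluated slot by
    slot. *)
Definition mxact1 g F i := \sum_j g i j * F j.

Definition mxact2 g (L : 'I_d -> 'I_d -> R) i j :=
  mxact1 g (fun i' => mxact1 g (fun j' => L i' j') j) i.

Definition mxact4 g (L : 'I_d -> 'I_d -> 'I_d -> 'I_d -> R) i j k l :=
  mxact1 g (fun i' => mxact1 g (fun j' => mxact1 g (fun k' => mxact1 g (fun l' =>
    L i' j' k' l') l) k) j) i.

(** The reflection [[x, y], [y, -x]] in the plane of the coordinates a and b.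
    With (x, y) = (1, 0) it is a sign change, with (0, 1) a transposition. *)
Definition refl_mx a b (x y : R) : 'M[R]_d := \matrix_(i, j)
  ((j == i)%:R + (x - 1) * (i == a)%:R * (j == a)%:R
   - (x + 1) * (i == b)%:R * (j == b)%:R
   + y * (i == a)%:R * (j == b)%:R + y * (i == b)%:R * (j == a)%:R).

Lemma sum_delta F i : \sum_j (j == i)%:R * F j = F i.
Proof.
rewrite (bigD1 i) //= eqxx mul1r big1 ?addr0 // => j /negbTE->.
by rewrite mul0r.
Qed.

Lemma mxact1_refl a b x y F i : a != b -> mxact1 (refl_mx a b x y) F i =
  if i == a then x * F a + y * F b
  else if i == b then y * F a - x * F b else F i.
Proof.
move=> ab; transitivity (\sum_j ((j == i)%:R * F j
    + (x - 1) * (i == a)%:R * ((j == a)%:R * F j)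
    + - ((x + 1) * (i == b)%:R) * ((j == b)%:R * F j)
    + y * (i == a)%:R * ((j == b)%:R * F j)
    + y * (i == b)%:R * ((j == a)%:R * F j))).
  by apply: eq_bigr => j _; rewrite mxE; ring.
rewrite !big_split /= -!mulr_sumr !sum_delta.
have [->|ia] := eqVneq i a; first by rewrite (negbTE ab) /=; ring.
by have [->|ib] := eqVneq i b; rewrite /=; ring.
Qed.

Lemma refl_mx_sym a b x y : (refl_mx a b x y)^T = refl_mx a b x y.
Proof. by apply/matrixP => i j; rewrite !mxE [i == j]eq_sym; ring. Qed.

Lemma refl_mx_orthogonal a b x y : a != b -> x ^+ 2 + y ^+ 2 = 1 ->
  (refl_mx a b x y)^T *m refl_mx a b x y == 1%:M.
Proof.
move=> ab xy; rewrite refl_mx_sym; apply/eqP/matrixP => i j; rewrite mxE.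
transitivity (mxact1 (refl_mx a b x y) (fun l => refl_mx a b x y l j) i) => //.
rewrite mxact1_refl // !mxE !eqxx [b == a]eq_sym (negbTE ab).
have [->|ia] := eqVneq i a.
  transitivity ((x ^+ 2 + y ^+ 2) * (j == a)%:R); first by rewrite /=; ring.
  by rewrite xy mul1r eq_sym.
have [->|ib] := eqVneq i b.
  transitivity ((x ^+ 2 + y ^+ 2) * (j == b)%:R); first by rewrite /=; ring.
  by rewrite xy mul1r eq_sym.
by rewrite /= [j == i]eq_sym; ring.
Qed.

End CoordinateReflections.

Section Isotropy.
Variables (R : realType) (d : nat) (K : eqType) (col : 'I_d -> K).
Variables (r0 r1 : K -> 'I_d).
Hypotheses (col0 : cancel r0 col) (col1 : cancel r1 col).
Hypothesis r01 : forall u, r0 u != r1 u.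
Implicit Types (i j k l a b : 'I_d).

Lemma exists_partner b : exists2 a, a != b & col a = col b.
Proof.
have [r0b|] := eqVneq (r0 (col b)) b; last by exists (r0 (col b)).
by exists (r1 (col b)); rewrite ?col1 // -{2}r0b eq_sym.
Qed.

Lemma exists_rep_neq u v : r0 u != r1 v.
Proof.
apply/eqP => h; have /eqP[] := r01 u.
by rewrite {2}(_ : u = v) // -(col0 u) h col1.
Qed.

(** Two ordered pairs of distinct indices with the same colours are joined by at
    most two transpositions inside colour classes, provided that the
    intermediate pair is again made of distinct indices. *)
Lemma color_pair (G : 'I_d -> 'I_d -> R) :
  (forall a b i j, a != b -> col a = col b -> G (tperm a b i) (tperm a b j) = G i j) ->
  forall i j i' j', i != j -> i' != j' -> col i = col i' -> col j = col j' ->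
    G i j = G i' j'.
Proof.
move=> Ginv.
have move1 i i' j : i != j -> i' != j -> col i = col i' -> G i j = G i' j.
  move=> ij i'j ci; have [->//|ii'] := eqVneq i i'.
  by rewrite -(Ginv i i' i j ii' ci) tpermL tpermD // eq_sym.
have move2 i j j' : i != j -> i != j' -> col j = col j' -> G i j = G i j'.
  move=> ij ij' cj; have [->//|jj'] := eqVneq j j'.
  by rewrite -(Ginv j j' i j jj' cj) tpermL tpermD // eq_sym.
move=> i j i' j' ij i'j' ci cj; have [i'j|i'j] := eqVneq i' j; last first.
  by rewrite (move1 i i' j) // (move2 i' j j').
have [j'i|j'i] := eqVneq j' i; last first.
  have ij' : i != j' by rewrite eq_sym.
  by rewrite (move2 i j j') // (move1 i i' j').
rewrite i'j j'i in ci *.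
by rewrite -(Ginv i j i j ij ci) tpermL tpermR.
Qed.

Lemma mxact1_flip a b (F : 'I_d -> R) i : a != b ->
  mxact1 (refl_mx a b 1 0) F i = (-1) ^+ (i == b) * F i.
Proof.
move=> ab; rewrite mxact1_refl //.
have [->|ia] := eqVneq i a; first by rewrite (negbTE ab); ring.
by have [->|ib] := eqVneq i b; rewrite ?expr1; ring.
Qed.

Lemma mxact1_swap a b (F : 'I_d -> R) i : a != b ->
  mxact1 (refl_mx a b 0 1) F i = F (tperm a b i).
Proof.
move=> ab; rewrite mxact1_refl //.
have [->|ia] := eqVneq i a; first by rewrite tpermL; ring.
have [->|ib] := eqVneq i b; first by rewrite tpermR; ring.
by rewrite tpermD // eq_sym.
Qed.

(** The coordinates are coloured, and only reflections that mix two coordinates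
    of one colour are assumed to fix L: one colour gives the full orthogonal
    group, two colours the stabiliser of a coordinate subspace.  Each colour
    must have two representatives r0 and r1, so that signs can be changed. *)
Lemma isotropic2 (L : 'I_d -> 'I_d -> R) :
  (forall a b x y, a != b -> col a = col b -> x ^+ 2 + y ^+ 2 = 1 ->
     forall i j, mxact2 (refl_mx a b x y) L i j = L i j) ->
  exists X : K -> R, forall i j, L i j = X (col i) * (i == j)%:R.
Proof.
move=> Linv; exists (fun u => L (r0 u) (r0 u)) => i j.
have [<-|ij] := eqVneq i j; rewrite ?mulr1 ?mulr0.
  have [->|ir] := eqVneq i (r0 (col i)); first by rewrite col0.
  have := Linv i (r0 (col i)) 0 1 ir; rewrite col0 expr0n expr1n add0r.
  by move=> /(_ erefl erefl i i); rewrite /mxact2 !mxact1_swap // tpermL => ->.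
have [a aj ca] := exists_partner j.
have := Linv a j 1 0 aj ca; rewrite expr0n expr1n addr0 => /(_ erefl i j).
rewrite /mxact2 !mxact1_flip // (negbTE ij) eqxx expr0 expr1; lra.
Qed.

(** Sign changes kill the entries in which some index occurs an odd number of
    times, and transpositions show that the entries with two pairs of distinct
    indices depend only on the colours.  The remaining entries L a a a a are
    determined by a reflection that is not a signed permutation. *)
Lemma isotropic4 (L : 'I_d -> 'I_d -> 'I_d -> 'I_d -> R) :
  (forall a b x y, a != b -> col a = col b -> x ^+ 2 + y ^+ 2 = 1 ->
     forall i j k l, mxact4 (refl_mx a b x y) L i j k l = L i j k l) ->
  exists X Y Z : K -> K -> R, forall i j k l, L i j k l =
    X (col i) (col k) * ((i == j)%:R * (k == l)%:R)
    + Y (col i) (col j) * ((i == k)%:R * (j == l)%:R)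
    + Z (col i) (col j) * ((i == l)%:R * (j == k)%:R).
Proof.
move=> Linv.
have odd0 b i j k l :
    odd ((i == b) + (j == b) + (k == b) + (l == b)) -> L i j k l = 0.
  move=> o; have [a ab ca] := exists_partner b.
  have := Linv a b 1 0 ab ca; rewrite expr0n expr1n addr0 => /(_ erefl i j k l).
  rewrite /mxact4 !mxact1_flip // !mulrA -!exprD -signr_odd o expr1; lra.
have swap a b i j k l : a != b -> col a = col b ->
    L (tperm a b i) (tperm a b j) (tperm a b k) (tperm a b l) = L i j k l.
  move=> ab ca; have := Linv a b 0 1 ab ca; rewrite expr0n expr1n add0r.
  by move=> /(_ erefl i j k l); rewrite /mxact4 !mxact1_swap.
have diag a b : a != b -> col a = col b ->
    L a a a a = L a a b b + L a b a b + L a b b a.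
  (* Any point of the unit circle off the coordinate axes would do; this one
     is rational. *)
  move=> ab ca; have := Linv a b (3/5) (4/5) ab ca.
  have -> : (3/5 : R) ^+ 2 + (4/5) ^+ 2 = 1 by field.
  have ba : (b == a) = false by rewrite eq_sym (negbTE ab).
  have aF : (a == b) = false by rewrite (negbTE ab).
  move=> /(_ erefl a a a a); rewrite /mxact4 !mxact1_refl // !eqxx.
  rewrite !(odd0 a b a a a) ?(odd0 a a b a a) ?(odd0 a a a b a) ?(odd0 a a a a b)
    ?(odd0 a a b b b) ?(odd0 a b a b b) ?(odd0 a b b a b) ?(odd0 a b b b a)
    ?eqxx ?ba ?aF //.
  have := swap a b a a a a ab ca; have := swap a b a a b b ab ca.
  have := swap a b a b a b ab ca; have := swap a b a b b a ab ca.
  by rewrite !tpermL !tpermR => *; lra.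
have pairs G (Ginv : forall a b i j, a != b -> col a = col b ->
    G (tperm a b i) (tperm a b j) = G i j) i j : i != j ->
    G i j = G (r0 (col i)) (r1 (col j)) :> R.
  move=> ij; apply: (color_pair Ginv); rewrite ?col0 ?col1 //.
  exact: exists_rep_neq.
have pX i k : i != k -> L i i k k =
    L (r0 (col i)) (r0 (col i)) (r1 (col k)) (r1 (col k)).
  by apply: (pairs (fun i k => L i i k k)) => a b i' k' ab ca; exact: swap.
have pY i j : i != j -> L i j i j =
    L (r0 (col i)) (r1 (col j)) (r0 (col i)) (r1 (col j)).
  by apply: (pairs (fun i j => L i j i j)) => a b i' k' ab ca; exact: swap.
have pZ i j : i != j -> L i j j i =
    L (r0 (col i)) (r1 (col j)) (r1 (col j)) (r0 (col i)).
  by apply: (pairs (fun i j => L i j j i)) => a b i' k' ab ca; exact: swap.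
exists (fun u v => L (r0 u) (r0 u) (r1 v) (r1 v)),
  (fun u v => L (r0 u) (r1 v) (r0 u) (r1 v)),
  (fun u v => L (r0 u) (r1 v) (r1 v) (r0 u)) => i j k l.
have [<-|ij] := eqVneq i j.
  have [<-|kl] := eqVneq k l.
    have [<-|ik] := eqVneq i k.
      have [b bi cb] := exists_partner i.
      have ib : i != b by rewrite eq_sym.
      rewrite (diag i b) // pX // pY // pZ // cb /=; ring.
    by rewrite pX // /=; ring.
  have [ik|ik] := eqVneq i k.
    rewrite -ik in kl *; rewrite (negbTE kl) (odd0 l) ?eqxx ?(negbTE kl) // /=; ring.
  have [il|il] := eqVneq i l.
    rewrite (odd0 k) ?eqxx ?(negbTE ik) ?(eq_sym l k) ?(negbTE kl) // /=; ring.
  rewrite (odd0 k) ?eqxx ?(negbTE ik) ?(eq_sym l k) ?(negbTE kl) // /=; ring.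
have [ik|ik] := eqVneq i k.
  rewrite -ik; have [jl|jl] := eqVneq j l.
    by rewrite -jl (negbTE ij) pY // [j == i]eq_sym (negbTE ij) /=; ring.
  rewrite (odd0 j) ?eqxx ?(negbTE ij) ?(eq_sym l j) ?(negbTE jl) //.
  by rewrite [j == i]eq_sym (negbTE ij) /=; ring.
have [il|il] := eqVneq i l.
  rewrite -il; have [jk|jk] := eqVneq j k.
    by rewrite -jk pZ // /=; ring.
  by rewrite (odd0 j) ?eqxx ?(negbTE ij) ?(eq_sym k j) ?(negbTE jk) // /=; ring.
rewrite (odd0 i) ?eqxx ?(eq_sym j i) ?(eq_sym k i) ?(eq_sym l i)
  ?(negbTE ij) ?(negbTE ik) ?(negbTE il) // /=; ring.
Qed.

End Isotropy.

(** * Tensor representations and Weyl modules *)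

(** A subspace of maximal dimension inside W is all of W. *)
Lemma exists_vspace_of_set (R : realType) (vT : vectType R) (W : set vT) :
  W 0 -> (forall a x y, W x -> W y -> W (a *: x + y)) ->
  exists U : {vspace vT}, forall x, x \in U <-> W x.
Proof.
move=> W0 Wlin.
pose p n := `[< exists U : {vspace vT}, \dim U = n /\ forall x, x \in U -> W x >].
have p0 : exists n, p n.
  exists 0; apply/asboolP; exists 0%VS; rewrite dimv0; split=> // x.
  by rewrite memv0 => /eqP ->.
have pB n : p n -> (n <= \dim {:vT})%N.
  by move=> /asboolP[U [<- _]]; apply: dimvS; exact: subvf.
have [n /asboolP[U [dU UW]] nmax] := ex_maxnP p0 pB.
exists U => x; split=> [|Wx]; first exact: UW.
suff /eqP -> : U == (U + <[x]>)%VS 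
  by apply: (subvP (addvSr U <[x]>)); exact: memv_line.
rewrite eqEdim addvSl dU; apply: nmax; apply/asboolP; exists (U + <[x]>)%VS.
split=> // _ /memv_addP[u uU [_ /vlineP[a ->] ->]].
by rewrite addrC; apply: Wlin => //; exact: UW.
Qed.

Section Tensors.
Variables (R : realType) (d : nat).
Local Notation tensor := (tensor R d).
Local Notation index n := {ffun 'I_n -> 'I_d}.

Definition tdot n (T U : tensor n) : R := \sum_(i : index n) T i * U i.

Lemma tdotC n (T U : tensor n) : tdot T U = tdot U T.
Proof. by apply: eq_bigr => i _; rewrite mulrC. Qed.

Lemma tdotPl n a (T T' U : tensor n) :
  tdot (a *: T + T') U = a * tdot T U + tdot T' U.
Proof.
rewrite mulr_sumr -big_split; apply: eq_bigr => i _ /=.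
by rewrite !ffunE mulrDl -mulrA.
Qed.

Lemma tdot_suml n (I : Type) (r : seq I) (c : I -> R) (F : I -> tensor n) U :
  tdot (\sum_(i <- r) c i *: F i) U = \sum_(i <- r) c i * tdot (F i) U.
Proof.
elim: r => [|i r IH]; last by rewrite !big_cons tdotPl IH.
by rewrite !big_nil /tdot big1 // => i _; rewrite ffunE mul0r.
Qed.

Lemma tdot_eq0 n (T : tensor n) : tdot T T = 0 -> T = 0.
Proof.
move=> TT; apply/ffunP => i; rewrite [RHS]ffunE.
have /psumr_eq0P/(_ i isT) : \sum_(i : index n) T i * T i = 0 by [].
move=> h; apply/eqP; rewrite -[_ == _](sqrf_eq0 (T i : R)) expr2; apply/eqP.
by apply: h => j _; rewrite -expr2 sqr_ge0.
Qed.

(** The Gram matrix of a basis of W is invertible because the inner product is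
    definite, and solving against it yields a representative inside W. *)
Lemma tensor_riesz n (W : set (tensor n)) (phi : tensor n -> R) :
  W 0 -> (forall a T U, W T -> W U -> W (a *: T + U)) ->
  (forall a T U, W T -> W U -> phi (a *: T + U) = a * phi T + phi U) ->
  exists2 L, W L & forall T, W T -> phi T = tdot L T.
Proof.
move=> W0 Wlin philin; have [U UW] := exists_vspace_of_set W0 Wlin.
pose m := \dim U; pose b := vbasis U.
have bW (i : 'I_m) : W b`_i by apply/UW/vbasis_mem; rewrite mem_nth // size_tuple.
have phi0 : phi 0 = 0.
  by have := philin 1 0 0 W0 W0; rewrite scale1r addr0 mul1r; lra.
have comb (c : 'I_m -> R) : W (\sum_i c i *: b`_i) /\
    phi (\sum_i c i *: b`_i) = \sum_i c i * phi b`_i.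
  elim: (index_enum _) => [|i r [IHW IHphi]]; first by rewrite !big_nil.
  by rewrite !big_cons; split; [exact: Wlin|rewrite philin // IHphi].
pose G : 'M[R]_m := \matrix_(i, j) tdot b`_i b`_j.
have Gunit : G \in unitmx.
  rewrite -row_free_unit -kermx_eq0; apply/eqP/row_matrixP => r.
  rewrite row0; set v := row r _.
  have vG : v *m G = 0 by apply/sub_kermxP; exact: row_sub.
  pose x := \sum_i v 0 i *: b`_i.
  have xb (j : 'I_m) : tdot x b`_j = 0.
    transitivity ((v *m G) 0 j); last by rewrite vG mxE.
    rewrite tdot_suml [RHS]mxE.
    by apply: eq_bigr => i _; rewrite [G i j]mxE.
  have x0 : x = 0.
    apply: tdot_eq0; rewrite {1}/x tdot_suml big1 // => i _.
    by rewrite tdotC xb mulr0.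
  have /freeP/(_ (fun i => v 0 i) x0) v0 := basis_free (vbasisP U).
  by apply/rowP => i; rewrite v0 mxE.
pose c := (\row_j phi b`_j) *m invmx G.
have cG (j : 'I_m) : \sum_i c 0 i * tdot b`_i b`_j = phi b`_j.
  have : (c *m G) 0 j = phi b`_j by rewrite mulmxKV // mxE.
  by rewrite mxE => <-; apply: eq_bigr => i _; rewrite [G i j]mxE.
exists (\sum_i c 0 i *: b`_i); first by case: (comb (fun i => c 0 i)).
move=> T /UW /coord_vbasis ->.
have [_ ->] := comb (fun i => coord b i T).
rewrite tdotC tdot_suml.
apply: eq_bigr => j _.
by rewrite -cG tdotC tdot_suml.
Qed.

Lemma tensor_act_linear n (g : orthogonal_group R d) a (T U : tensor n) :
  tensor_act g (a *: T + U) = a *: tensor_act g T + tensor_act g U.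
Proof.
apply/ffunP => i; rewrite !ffunE scaler_sumr -big_split; apply: eq_bigr => j _ /=.
by rewrite !ffunE mulrDr; congr (_ + _); rewrite mulrCA.
Qed.

Lemma tdot_tensor_act_sym n (g : orthogonal_group R d) (T U : tensor n) :
  (val g)^T = val g -> tdot (tensor_act g T) U = tdot T (tensor_act g U).
Proof.
move=> gT; rewrite /tdot.
under eq_bigr do rewrite ffunE mulr_suml.
under [RHS]eq_bigr do rewrite ffunE mulr_sumr.
rewrite exchange_big; apply: eq_bigr => i _; apply: eq_bigr => j _ /=.
rewrite -mulrA mulrCA; congr (_ * (_ * _)).
by apply: eq_bigr => a _; rewrite -{1}gT mxE.
Qed.

Lemma place_perm_linear n s a (T U : tensor n) :
  place_perm s (a *: T + U) = a *: place_perm s T + place_perm s U.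
Proof. by apply/ffunP => i; rewrite !ffunE. Qed.

Lemma place_perm_act n (s : 'S_n) (g : orthogonal_group R d) (T : tensor n) :
  place_perm s (tensor_act g T) = tensor_act g (place_perm s T).
Proof.
apply/ffunP => i; rewrite !ffunE.
pose h (j : index n) : index n := [ffun a => j (s a)].
pose h' (j : index n) : index n := [ffun a => j (s^-1%g a)].
rewrite (reindex h) /=; last first.
  by exists h' => j _; apply/ffunP => a; rewrite !ffunE ?permK ?permKV.
apply: eq_bigr => j _; rewrite !ffunE; congr (_ * _).
rewrite [RHS](reindex_inj (@perm_inj _ s)) /=.
by apply: eq_bigr => a _; rewrite !ffunE.
Qed.

Section WeylModule.
Variable lambda : seq nat.
Local Notation young := (@young_symmetrizer R d lambda).

Lemma young_linear a T U : young (a *: T + U) = a *: young T + young U.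
Proof.
rewrite /young_symmetrizer scaler_sumr -big_split; apply: eq_bigr => p _ /=.
rewrite scaler_sumr -big_split; apply: eq_bigr => q _ /=.
by rewrite !place_perm_linear scalerDr !scalerA mulrC.
Qed.

Lemma young_act g T : young (tensor_act g T) = tensor_act g (young T).
Proof.
have act0 : tensor_act g (0 : tensor (sumn lambda)) = 0.
  by apply/ffunP => i; rewrite !ffunE big1 // => j _; rewrite ffunE mulr0.
have actD (T' U' : tensor (sumn lambda)) :
    tensor_act g (T' + U') = tensor_act g T' + tensor_act g U'.
  by have := tensor_act_linear g 1 T' U'; rewrite !scale1r.
have actZ a (T' : tensor (sumn lambda)) : tensor_act g (a *: T') = a *: tensor_act g T'.
  by have := tensor_act_linear g a T' 0; rewrite act0 !addr0.
rewrite /young_symmetrizer (big_morph _ actD act0); apply: eq_bigr => p _.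
rewrite (big_morph _ actD act0); apply: eq_bigr => q _.
by rewrite actZ !place_perm_act.
Qed.

Lemma weyl_module0 : weyl_module (0 : tensor (sumn lambda)).
Proof.
split; first by move=> a b _ i; rewrite big1 // => c _; rewrite ffunE.
exists 0; have := young_linear 1 0 0.
by rewrite !scale1r addr0 => /eqP; rewrite -subr_eq0 opprD addrA subrr sub0r oppr_eq0 => /eqP.
Qed.

Lemma traceless_linear n a (T U : tensor n) :
  traceless T -> traceless U -> traceless (a *: T + U).
Proof.
move=> trT trU x y xy i.
transitivity (a * \sum_(c < d) T [ffun z => if (z == x) || (z == y) then c else i z]
  + \sum_(c < d) U [ffun z => if (z == x) || (z == y) then c else i z]).
  by rewrite mulr_sumr -big_split; apply: eq_bigr => c _; rewrite !ffunE.
by rewrite trT // trU // mulr0 addr0.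
Qed.

Lemma weyl_module_linear a (T U : tensor (sumn lambda)) :
  weyl_module T -> weyl_module U -> weyl_module (a *: T + U).
Proof.
move=> [trT [T' TT']] [trU [U' UU']]; split; first exact: traceless_linear.
by exists (a *: T' + U'); rewrite young_linear TT' UU'.
Qed.

(** Summing the matrix coefficients over the common value of the indices x and y
    gives the entries of g^T g = 1, so that only the indices j with j x = j y
    survive; grouping those by their values away from x and y leaves traces of
    T. *)
Lemma traceless_act n g (T : tensor n) : traceless T -> traceless (tensor_act g T).
Proof.
move=> trT x y xy i; under eq_bigr do rewrite ffunE.
rewrite exchange_big /=.
pose ix c (k : index n) : index n :=
  [ffun z => if (z == x) || (z == y) then c else k z].
have ggE c e : \sum_b val g b c * val g b e = (c == e)%:R.
  have /eqP/matrixP/(_ c e) := valP g; rewrite !mxE => <-.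
  by apply: eq_bigr => b _; rewrite mxE.
pose Q (j : index n) := \prod_(a | (a != x) && (a != y)) val g (i a) (j a).
have prodE c (j : index n) : \prod_(a < n) val g (ix c i a) (j a) =
    val g c (j x) * val g c (j y) * Q j.
  rewrite (bigD1 x) // (bigD1 y) 1?eq_sym //= !ffunE !eqxx orbT mulrA.
  congr (_ * _); apply: eq_bigr => a /andP[/negbTE ax /negbTE ay].
  by rewrite ffunE ax ay.
have -> : \sum_(j : index n) \sum_(c < d) \prod_(a < n) val g (ix c i a) (j a) * T j =
    \sum_(j : index n | j x == j y) Q j * T j.
  rewrite [RHS]big_mkcond; apply: eq_bigr => j _ /=.
  under eq_bigr do rewrite prodE -mulrA.
  rewrite -mulr_suml ggE; case: ifP => _; last by rewrite mul0r.
  by rewrite mul1r.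
(* Any filler would do; i x is one at hand in a possibly empty 'I_d. *)
pose h := ix (i x); rewrite (partition_big h xpredT) //= big1 // => k _.
rewrite (reindex_onto (fun c => ix c k) (fun j => j x)) /=; last first.
  move=> j /andP[/eqP jxy /eqP <-]; apply/ffunP => z; rewrite !ffunE.
  by have [->|_] := eqVneq z x => //=; have [->|_] := eqVneq z y.
have condE c : [&& (ix c k x == ix c k y) && (h (ix c k) == k) & ix c k x == c] =
    (h k == k).
  rewrite !ffunE !eqxx orbT eqxx andbT /=; congr (_ == _).
  by apply/ffunP => z; rewrite !ffunE; case: (_ || _).
under eq_bigl do rewrite condE.
case: (h k == k); last by rewrite big_pred0_eq.
have QE c : Q (ix c k) = Q k.
  by apply: eq_bigr => a /andP[/negbTE ax /negbTE ay]; rewrite ffunE ax ay.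
by under eq_bigr do rewrite QE; rewrite -mulr_sumr trT // mulr0.
Qed.

Lemma weyl_module_act g (T : tensor (sumn lambda)) :
  weyl_module T -> weyl_module (tensor_act g T).
Proof.
move=> [trT [T' TT']]; split; first exact: traceless_act.
by exists (tensor_act g T'); rewrite young_act TT'.
Qed.

End WeylModule.
End Tensors.

(** * Contractions of tensors of order two and four *)

Section LowDegreeTensors.
Variables (R : realType) (d : nat).
Local Notation index n := {ffun 'I_n -> 'I_d}.
Local Notation tensor := (tensor R d).
Implicit Types (i j k l : 'I_d).

Definition idx2 i j : index 2 := [ffun a : 'I_2 => nth i [:: i; j] a].

Definition idx4 i j k l : index 4 := [ffun a : 'I_4 => nth i [:: i; j; k; l] a].

Lemma sum_idx2 (F : index 2 -> R) : \sum_f F f = \sum_i \sum_j F (idx2 i j).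
Proof.
rewrite pair_bigA /=.
pose h (p : 'I_d * 'I_d) := idx2 p.1 p.2.
rewrite (reindex h) //; exists (fun f : index 2 => (f 0, f 1)).
  by move=> [i j] _; rewrite /h !ffunE.
move=> f _; apply/ffunP => -[[|[|//]] a2]; rewrite ffunE /=.
  by congr (f _); apply/val_inj.
by congr (f _); apply/val_inj.
Qed.

Lemma sum_idx4 (F : index 4 -> R) :
  \sum_f F f = \sum_i \sum_j \sum_k \sum_l F (idx4 i j k l).
Proof.
rewrite !pair_bigA /=.
pose h (p : 'I_d * 'I_d * 'I_d * 'I_d) := idx4 p.1.1.1 p.1.1.2 p.1.2 p.2.
pose o m (H : (m < 4)%N) : 'I_4 := Ordinal H.
rewrite (reindex h) //.
exists (fun f : index 4 => (f (o 0%N isT), f (o 1%N isT), f (o 2 isT), f (o 3 isT))).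
  by move=> [[[i j] k] l] _; rewrite /h !ffunE.
move=> f _; apply/ffunP => -[[|[|[|[|//]]]] a4]; rewrite ffunE /=;
  by congr (f _); apply/val_inj.
Qed.

Definition entries2 (T : tensor 2) i j : R := T (idx2 i j).
Definition entries4 (T : tensor 4) i j k l : R := T (idx4 i j k l).

Lemma entries2_act g (T : tensor 2) i j :
  entries2 (tensor_act g T) i j = mxact2 (val g) (entries2 T) i j.
Proof.
rewrite /entries2 ffunE sum_idx2; apply: eq_bigr => i' _.
rewrite mulr_sumr; apply: eq_bigr => j' _.
by rewrite !big_ord_recl big_ord0 !ffunE /= mulr1 mulrA.
Qed.

Lemma entries4_act g (T : tensor 4) i j k l :
  entries4 (tensor_act g T) i j k l = mxact4 (val g) (entries4 T) i j k l.
Proof.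
rewrite /entries4 ffunE sum_idx4; apply: eq_bigr => i' _.
rewrite mulr_sumr; apply: eq_bigr => j' _; rewrite !mulr_sumr.
apply: eq_bigr => k' _; rewrite !mulr_sumr; apply: eq_bigr => l' _.
by rewrite !big_ord_recl big_ord0 !ffunE /= mulr1 !mulrA.
Qed.

Definition trace_free4 (T : 'I_d -> 'I_d -> 'I_d -> 'I_d -> R) :=
  [/\ (forall k l, \sum_i T i i k l = 0), (forall j l, \sum_i T i j i l = 0),
      (forall j k, \sum_i T i j k i = 0), (forall i l, \sum_j T i j j l = 0) &
      (forall i k, \sum_j T i j k j = 0) /\ (forall i j, \sum_k T i j k k = 0)].

Lemma traceless_trace2 (T : tensor 2) :
  traceless T -> \sum_i entries2 T i i = 0.
Proof.
move=> trT; case: (posnP d) => [d0|d0].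
  by rewrite big1 // => i; have := ltn_ord i; rewrite [X in (_ < X)%N]d0.
pose o := Ordinal d0; apply: (etrans _ (trT 0 1 isT (idx2 o o))).
apply: eq_bigr => c _; congr (T _); apply/ffunP => -[[|[|//]] h];
  by rewrite !ffunE.
Qed.

Lemma traceless_trace_free4 (T : tensor 4) :
  traceless T -> trace_free4 (entries4 T).
Proof.
move=> trT; pose o m (H : (m < 4)%N) : 'I_4 := Ordinal H.
pose o0 := o 0%N isT; pose o1 := o 1%N isT; pose o2 := o 2 isT; pose o3 := o 3 isT.
split; last split.
- move=> k l; apply: (etrans _ (trT o0 o1 isT (idx4 k k k l))); apply: eq_bigr => c _.
  congr (T _); apply/ffunP => -[[|[|[|[|//]]]] h]; by rewrite !ffunE.
- move=> j l; apply: (etrans _ (trT o0 o2 isT (idx4 j j j l))); apply: eq_bigr => c _.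
  congr (T _); apply/ffunP => -[[|[|[|[|//]]]] h]; by rewrite !ffunE.
- move=> j k; apply: (etrans _ (trT o0 o3 isT (idx4 j j k k))); apply: eq_bigr => c _.
  congr (T _); apply/ffunP => -[[|[|[|[|//]]]] h]; by rewrite !ffunE.
- move=> i l; apply: (etrans _ (trT o1 o2 isT (idx4 i i i l))); apply: eq_bigr => c _.
  congr (T _); apply/ffunP => -[[|[|[|[|//]]]] h]; by rewrite !ffunE.
- move=> i k; apply: (etrans _ (trT o1 o3 isT (idx4 i i k k))); apply: eq_bigr => c _.
  congr (T _); apply/ffunP => -[[|[|[|[|//]]]] h]; by rewrite !ffunE.
- move=> i j; apply: (etrans _ (trT o2 o3 isT (idx4 i j j j))); apply: eq_bigr => c _.
  congr (T _); apply/ffunP => -[[|[|[|[|//]]]] h]; by rewrite !ffunE.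
Qed.

Lemma mxact1C (g h : 'M[R]_d) (F : 'I_d -> 'I_d -> R) i j :
  mxact1 g (fun i' => mxact1 h (fun j' => F i' j') j) i =
  mxact1 h (fun j' => mxact1 g (fun i' => F i' j') i) j.
Proof.
rewrite /mxact1; under eq_bigr do rewrite mulr_sumr.
rewrite exchange_big; apply: eq_bigr => j' _ /=; rewrite mulr_sumr.
by apply: eq_bigr => i' _; rewrite mulrCA.
Qed.

Definition contract4 (M T : 'I_d -> 'I_d -> 'I_d -> 'I_d -> R) : R :=
  \sum_i \sum_j \sum_k \sum_l M i j k l * T i j k l.

Definition tens_sq (P : 'M[R]_d) i j k l : R := P i j * P k l.

(** Permutations of the slots of T that bring the pairings (13)(24) and (14)(23)
    to the form (12)(34). *)
Definition swap23 (T : 'I_d -> 'I_d -> 'I_d -> 'I_d -> R) i j k l := T i k j l.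
Definition cycle234 (T : 'I_d -> 'I_d -> 'I_d -> 'I_d -> R) i j k l := T i k l j.

Lemma contract4_pairings (K : Type) (col : 'I_d -> K) (X Y Z : K -> K -> R)
    (M T : 'I_d -> 'I_d -> 'I_d -> 'I_d -> R) :
  (forall i j k l, M i j k l =
    X (col i) (col k) * ((i == j)%:R * (k == l)%:R)
    + Y (col i) (col j) * ((i == k)%:R * (j == l)%:R)
    + Z (col i) (col j) * ((i == l)%:R * (j == k)%:R)) ->
  contract4 M T = \sum_i \sum_j X (col i) (col j) * T i i j j
    + \sum_i \sum_j Y (col i) (col j) * swap23 T i i j j
    + \sum_i \sum_j Z (col i) (col j) * cycle234 T i i j j.
Proof.
move=> ME; rewrite -!big_split /=; apply: eq_bigr => i _.
transitivity (\sum_j ((j == i)%:R * (\sum_k X (col i) (col k) * T i j k k)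
   + Y (col i) (col j) * T i j i j + Z (col i) (col j) * T i j j i)).
  apply: eq_bigr => j _.
  transitivity (\sum_k ((j == i)%:R * (X (col i) (col k) * T i j k k)
     + (k == i)%:R * (Y (col i) (col j) * T i j k j)
     + (k == j)%:R * (Z (col i) (col j) * T i j k i))).
    apply: eq_bigr => k _.
    transitivity (\sum_l ((l == k)%:R * ((j == i)%:R * (X (col i) (col k) * T i j k l))
     + (l == j)%:R * ((k == i)%:R * (Y (col i) (col j) * T i j k l))
     + (l == i)%:R * ((k == j)%:R * (Z (col i) (col j) * T i j k l)))).
      apply: eq_bigr => l _; rewrite ME [l == k]eq_sym [l == j]eq_sym [l == i]eq_sym.
      by rewrite [i == j]eq_sym [i == k]eq_sym [j == k]eq_sym; ring.
    by rewrite !big_split /= !sum_delta.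
  by rewrite !big_split /= !sum_delta mulr_sumr.
by rewrite !big_split /= sum_delta.
Qed.

(** Each pairing contracts two slots of T. *)
Lemma contract4_isotropic (x y z : R) (M T : 'I_d -> 'I_d -> 'I_d -> 'I_d -> R) :
  (forall i j k l, M i j k l = x * ((i == j)%:R * (k == l)%:R)
    + y * ((i == k)%:R * (j == l)%:R) + z * ((i == l)%:R * (j == k)%:R)) ->
  trace_free4 T -> contract4 M T = 0.
Proof.
move=> ME [t01 t02 t03 _ _].
rewrite (@contract4_pairings unit (fun=> tt) (fun _ _ => x) (fun _ _ => y)
  (fun _ _ => z)) //.
have zero c (F : 'I_d -> 'I_d -> R) : (forall j, \sum_i F i j = 0) ->
    \sum_i \sum_j c * F i j = 0.
  by move=> F0; rewrite exchange_big big1 // => j _; rewrite -mulr_sumr F0 mulr0.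
rewrite (zero _ (fun i j => T i i j j)) // (zero _ (fun i j => T i j i j)) //.
by rewrite (zero _ (fun i j => T i j j i)) // !addr0.
Qed.

Lemma trace_free4_swap23 T : trace_free4 T -> trace_free4 (swap23 T).
Proof.
move=> [t12 t13 t14 t23 [t24 t34]]; split; last split; move=> a b;
  by [exact: t12|exact: t13|exact: t14|exact: t23|exact: t24|exact: t34].
Qed.

Lemma trace_free4_cycle234 T : trace_free4 T -> trace_free4 (cycle234 T).
Proof.
move=> [t12 t13 t14 t23 [t24 t34]]; split; last split; move=> a b;
  by [exact: t12|exact: t13|exact: t14|exact: t23|exact: t24|exact: t34].
Qed.

Lemma mxact4_swap23 g T i j k l : mxact4 g (swap23 T) i j k l = swap23 (mxact4 g T) i j k l.
Proof.
rewrite /swap23 /mxact4; congr (mxact1 g _ i); apply/funext => i'.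
by rewrite [LHS]mxact1C.
Qed.

Lemma mxact4_cycle234 g T i j k l :
  mxact4 g (cycle234 T) i j k l = cycle234 (mxact4 g T) i j k l.
Proof.
rewrite /cycle234 /mxact4; congr (mxact1 g _ i); apply/funext => i'.
rewrite [LHS]mxact1C; congr (mxact1 g _ k); apply/funext => k'.
by rewrite [LHS]mxact1C.
Qed.

(** In this form the lemma passes from coordinates adapted to a plane, in which
    its projection is diagonal, to the original ones. *)
Lemma sum_pair_mxact1 (p : 'I_d -> R) (h P : 'M[R]_d) (F : 'I_d -> 'I_d -> R) :
  P = h^T *m diag_mx (\row_i p i) *m h ->
  \sum_a p a * mxact1 h (fun i => mxact1 h (fun j => F i j) a) a =
  \sum_i \sum_j P i j * F i j.
Proof.
move=> PE.
have PijE i j : P i j = \sum_a p a * h a i * h a j.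
  rewrite PE mxE; apply: eq_bigr => a _; congr (_ * _).
  rewrite mxE (bigD1 a) //= big1 ?addr0 => [|b ba].
    by rewrite !mxE eqxx mulr1n mulrC.
  by rewrite !mxE (negbTE ba) mulr0n mulr0.
under eq_bigr do rewrite mulr_sumr.
rewrite exchange_big /=; apply: eq_bigr => i _.
under eq_bigr do rewrite !mulr_sumr.
rewrite exchange_big /=; apply: eq_bigr => j _.
by rewrite PijE mulr_suml; apply: eq_bigr => a _; ring.
Qed.

Lemma sum_diag_mxact4 (p : 'I_d -> R) (h P : 'M[R]_d) T :
  P = h^T *m diag_mx (\row_i p i) *m h ->
  \sum_i \sum_j p i * p j * mxact4 h T i i j j = contract4 (tens_sq P) T.
Proof.
move=> PE.
transitivity (\sum_i p i * mxact1 h (fun i' => mxact1 h (fun j' =>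
    \sum_k \sum_l P k l * T i' j' k l) i) i).
  apply: eq_bigr => i _; under eq_bigr do rewrite -mulrA.
  rewrite -mulr_sumr; congr (_ * _).
  rewrite /mxact4 /mxact1; under eq_bigr do rewrite mulr_sumr.
  rewrite exchange_big /=; apply: eq_bigr => i' _.
  under eq_bigr do rewrite mulrCA mulr_sumr.
  rewrite -mulr_sumr; congr (_ * _); rewrite exchange_big /=.
  apply: eq_bigr => j' _; under eq_bigr do rewrite mulrCA.
  by rewrite -mulr_sumr -(sum_pair_mxact1 (fun k l => T i' j' k l) PE).
rewrite (sum_pair_mxact1 _ PE); apply: eq_bigr => i _; apply: eq_bigr => j _.
rewrite mulr_sumr; apply: eq_bigr => k _; rewrite mulr_sumr.
by apply: eq_bigr => l _; rewrite mulrA.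
Qed.

(** A function of two booleans is a combination of 1, u, v and uv; the first
    three contribute nothing because the marginal sums of F vanish. *)
Lemma sum_bool_pairing (c : 'I_d -> bool) (X : bool -> bool -> R)
    (F : 'I_d -> 'I_d -> R) :
  (forall j, \sum_i F i j = 0) -> (forall i, \sum_j F i j = 0) ->
  \sum_i \sum_j X (c i) (c j) * F i j =
  (X true true - X true false - X false true + X false false) *
    \sum_i \sum_j (c i)%:R * (c j)%:R * F i j.
Proof.
move=> F1 F2; rewrite mulr_sumr.
transitivity (\sum_i \sum_j
  ((X true true - X true false - X false true + X false false) *
      ((c i)%:R * (c j)%:R * F i j)
   + (X true false - X false false) * (c i)%:R * F i j
   + ((X false true - X false false) * (c j)%:R + X false false) * F i j)).
  apply: eq_bigr => i _; apply: eq_bigr => j _.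
  by case: (c i); case: (c j); rewrite /=; ring.
under eq_bigr do rewrite !big_split /= -!mulr_sumr F2 mulr0 addr0.
rewrite big_split /= [X in _ + X]exchange_big [X in _ + X]big1 ?addr0 //=.
by move=> j _; rewrite -mulr_sumr F1 mulr0.
Qed.

End LowDegreeTensors.

(** * Equivariant families of functions on planes *)

Section Intertwiners.
Variables (R : realType) (d : nat).

Definition refl_orth (a b : 'I_d) (x y : R) (ab : a != b) (xy : x ^+ 2 + y ^+ 2 = 1) :
  orthogonal_group R d := exist _ (refl_mx a b x y) (refl_mx_orthogonal ab xy).

Variables (n : nat) (W : set (tensor R d n)) (Phi : tensor R d n -> grass R 2 d -> R).
Hypotheses (W0 : W 0) (Wlin : forall a T U, W T -> W U -> W (a *: T + U))
  (Wact : forall g T, W T -> W (tensor_act g T)).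
Hypotheses (Phi_linear : forall (a : R) T U, W T -> W U ->
    forall V, Phi (a *: T + U) V = a * Phi T V + Phi U V)
  (Phi_equivariant : forall (g : orthogonal_group R d) T, W T ->
    forall V, Phi (tensor_act g T) (Defs.gact g V) = Phi T V).

(** The difference of L and its image under a symmetric g in the stabiliser of V0
    lies in W and is orthogonal to W. *)
Lemma intertwiner_kernel (V0 : grass R 2 d) : exists L : tensor R d n,
  (forall T, W T -> Phi T V0 = tdot L T) /\
  (forall g : orthogonal_group R d, (val g)^T = val g -> Defs.gact g V0 = V0 ->
    tensor_act g L = L).
Proof.
have [L WL LE] := tensor_riesz W0 Wlin (fun a T U WT WU => Phi_linear a WT WU V0).
exists L; split=> // g gT gV0; apply/eqP; rewrite -subr_eq0; apply/eqP/tdot_eq0.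
have WD : W (tensor_act g L - L).
  by rewrite addrC -scaleN1r; apply: Wlin => //; exact: Wact.
have inv T : W T -> tdot (tensor_act g L) T = tdot L T.
  move=> WT; rewrite tdot_tensor_act_sym // -LE; last exact: Wact.
  by rewrite -{1}gV0 Phi_equivariant // LE.
rewrite {1}addrC -scaleN1r tdotPl scaleN1r inv //.
by rewrite mulN1r addNr.
Qed.

End Intertwiners.

Section StandardPlane.
Variables (R : realType) (d : nat).
Hypothesis d_ge4 : (4 <= d)%N.
Let d_ge2 : (2 <= d)%N := leq2_of_leq4 d_ge4.

Definition in_plane (i : 'I_d) : bool := (i < 2)%N.

Lemma exists_standard_plane : exists V0 : grass R 2 d,
  orthproj_mx V0 = diag_mx (\row_i (in_plane i)%:R).
Proof.
have QQ : (pid_mx 2 : 'M[R]_(d, 2))^T *m pid_mx 2 = 1%:M.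
  by rewrite tr_pid_mx pid_mx_id // pid_mx_1.
have [V0 hV0] := exists_grass QQ; exists V0.
rewrite (orthproj_mx_basis hV0) tr_pid_mx pid_mx_id //.
apply/matrixP => i j; rewrite !mxE -[i == j]val_eqE /=.
by case: (val i == val j).
Qed.

Lemma refl_fix_standard (V0 : grass R 2 d) (a b : 'I_d) (x y : R)
    (ab : a != b) (xy : x ^+ 2 + y ^+ 2 = 1) :
  orthproj_mx V0 = diag_mx (\row_i (in_plane i)%:R) ->
  in_plane a = in_plane b -> Defs.gact (refl_orth ab xy) V0 = V0.
Proof.
move=> PE pab; apply: orthproj_mx_inj; rewrite orthproj_mx_gact.
have comm : refl_mx a b x y *m orthproj_mx V0 = orthproj_mx V0 *m refl_mx a b x y.
  rewrite PE; apply/matrixP => i j; rewrite mul_mx_diag mul_diag_mx !mxE.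
  have ind (u v : 'I_d) : in_plane u = in_plane v ->
      (i == u)%:R * (j == v)%:R * (in_plane j)%:R =
      (in_plane i)%:R * ((i == u)%:R * (j == v)%:R) :> R.
    move=> puv; have [->|] := eqVneq i u; last by rewrite !mul0r mulr0.
    by have [->|] := eqVneq j v; rewrite ?mulr0 ?mul0r ?mulr0 // puv; ring.
  have ij : (j == i)%:R * (in_plane j)%:R = (in_plane i)%:R * (j == i)%:R :> R.
    by have [->|] := eqVneq j i; rewrite ?mulr0 ?mul0r // mulrC.
  rewrite mulrDl mulrDl mulrBl mulrDl ij.
  have E1 := ind a a erefl; have E2 := ind b b erefl.
  have E3 := ind a b pab; have E4 := ind b a (esym pab).
  transitivity ((in_plane i)%:R * (j == i)%:R
    + (x - 1) * ((i == a)%:R * (j == a)%:R * (in_plane j)%:R)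
    - (x + 1) * ((i == b)%:R * (j == b)%:R * (in_plane j)%:R)
    + y * ((i == a)%:R * (j == b)%:R * (in_plane j)%:R)
    + y * ((i == b)%:R * (j == a)%:R * (in_plane j)%:R)); first by ring.
  by rewrite E1 E2 E3 E4; ring.
by rewrite /= comm -mulmxA refl_mx_sym -{1}refl_mx_sym
  (eqP (refl_mx_orthogonal ab xy)) mulmx1.
Qed.

(** Since d >= 4, both colours have two representatives: 0, 1 for the standard plane
    and 2, 3 for its complement. *)
Definition plane_rep (m : nat) (u : bool) : 'I_d :=
  Ordinal (leq_trans (ltn_pmod (if u then m else 2 + m) (isT : 0 < 4)%N) d_ge4).

Lemma plane_repK m : (m < 2)%N -> cancel (plane_rep m) in_plane.
Proof. by case: m => [|[|//]] _ []. Qed.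

Lemma plane_rep_neq u : plane_rep 0 u != plane_rep 1 u.
Proof. by case: u. Qed.

Section Degree.
Variable n : nat.
Variables (W : set (tensor R d n)) (Phi : tensor R d n -> grass R 2 d -> R).
Hypotheses (W0 : W 0) (Wlin : forall a T U, W T -> W U -> W (a *: T + U))
  (Wact : forall g T, W T -> W (tensor_act g T))
  (Wtraceless : forall T, W T -> traceless T).
Hypotheses (Phi_linear : forall (a : R) T U, W T -> W U ->
    forall V, Phi (a *: T + U) V = a * Phi T V + Phi U V)
  (Phi_equivariant : forall (g : orthogonal_group R d) T, W T ->
    forall V, Phi (tensor_act g T) (Defs.gact g V) = Phi T V).

(** V is carried to the standard plane by some h, and T is transported along
    h. *)
Lemma standard_kernel : exists L : tensor R d n,
  (forall a b x y (ab : a != b) (xy : x ^+ 2 + y ^+ 2 = 1),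
     in_plane a = in_plane b -> tensor_act (refl_orth ab xy) L = L) /\
  forall T, W T -> forall V : grass R 2 d, exists h : orthogonal_group R d,
    [/\ orthproj_mx V = (val h)^T *m diag_mx (\row_i (in_plane i)%:R) *m val h,
        traceless (tensor_act h T) & Phi T V = tdot L (tensor_act h T)].
Proof.
have [V0 PV0] := exists_standard_plane.
have [L [LE Linv]] := intertwiner_kernel W0 Wlin Wact Phi_linear Phi_equivariant V0.
exists L; split=> [a b x y ab xy pab|T WT V].
  by apply: Linv; [exact: refl_mx_sym|exact: refl_fix_standard].
have [h hV] := gact_transitive V V0; exists h.
have /eqP hh : (val h)^T *m val h == 1%:M by case: (h).
split.
- rewrite -PV0 hV orthproj_mx_gact !mulmxA hh mul1mx -mulmxA hh mulmx1 //.
- by apply: Wtraceless; exact: Wact.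
by rewrite -(Phi_equivariant h WT) -hV LE //; exact: Wact.
Qed.

End Degree.

Lemma intertwiner2 (W : set (tensor R d 2)) (Phi : tensor R d 2 -> grass R 2 d -> R) :
  W 0 -> (forall a T U, W T -> W U -> W (a *: T + U)) ->
  (forall g T, W T -> W (tensor_act g T)) -> (forall T, W T -> traceless T) ->
  (forall (a : R) T U, W T -> W U ->
    forall V, Phi (a *: T + U) V = a * Phi T V + Phi U V) ->
  (forall (g : orthogonal_group R d) T, W T ->
    forall V, Phi (tensor_act g T) (Defs.gact g V) = Phi T V) ->
  exists c : R, forall T, W T -> forall V,
    Phi T V = c * \sum_i \sum_j orthproj_mx V i j * entries2 T i j.
Proof.
move=> W0 Wlin Wact Wtr Plin Peq.
have [L [Linv LE]] := standard_kernel W0 Wlin Wact Wtr Plin Peq.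
have [|X XE] := isotropic2 (plane_repK (isT : 0 < 2)%N) (plane_repK (isT : 1 < 2)%N)
  plane_rep_neq (L := entries2 L).
  by move=> a b x y ab pab xy i j; rewrite -(entries2_act (refl_orth ab xy)) Linv.
exists (X true - X false) => T WT V.
have [h [PV trU ->]] := LE T WT V.
rewrite /tdot sum_idx2 -(sum_pair_mxact1 (entries2 T) PV).
transitivity (\sum_i X (in_plane i) * entries2 (tensor_act h T) i i).
  apply: eq_bigr => i _.
  transitivity (\sum_j (j == i)%:R * (X (in_plane i) * entries2 (tensor_act h T) i j)).
    apply: eq_bigr => j _; rewrite -/(entries2 L i j) XE [j == i]eq_sym.
    by rewrite -/(entries2 (tensor_act h T) i j); ring.
  by rewrite sum_delta.
transitivity (\sum_i ((X true - X false) *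
    ((in_plane i)%:R * entries2 (tensor_act h T) i i)
    + X false * entries2 (tensor_act h T) i i)).
  by apply: eq_bigr => i _; case: (in_plane i); rewrite /=; ring.
rewrite big_split /= -!mulr_sumr traceless_trace2 // mulr0 addr0.
by congr (_ * _); apply: eq_bigr => i _; rewrite entries2_act.
Qed.

(** The formula for L has four coefficients for each pairing, one for each pair of
    colours; a traceless tensor only sees their alternating sum, as the
    coefficient of the contraction with P_V (x) P_V. *)
Lemma intertwiner4 (W : set (tensor R d 4)) (Phi : tensor R d 4 -> grass R 2 d -> R) :
  W 0 -> (forall a T U, W T -> W U -> W (a *: T + U)) ->
  (forall g T, W T -> W (tensor_act g T)) -> (forall T, W T -> traceless T) ->
  (forall (a : R) T U, W T -> W U ->
    forall V, Phi (a *: T + U) V = a * Phi T V + Phi U V) ->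
  (forall (g : orthogonal_group R d) T, W T ->
    forall V, Phi (tensor_act g T) (Defs.gact g V) = Phi T V) ->
  exists c1 c2 c3 : R, forall T, W T -> forall V : grass R 2 d,
    let P := tens_sq (orthproj_mx V) in
    Phi T V = c1 * contract4 P (entries4 T) + c2 * contract4 P (swap23 (entries4 T))
      + c3 * contract4 P (cycle234 (entries4 T)).
Proof.
move=> W0 Wlin Wact Wtr Plin Peq.
have [L [Linv LE]] := standard_kernel W0 Wlin Wact Wtr Plin Peq.
have [|X [Y [Z XYZE]]] := isotropic4 (plane_repK (isT : 0 < 2)%N)
  (plane_repK (isT : 1 < 2)%N) plane_rep_neq (L := entries4 L).
  move=> a b x y ab pab xy i j k l.
  by rewrite -(entries4_act (refl_orth ab xy)) Linv.
pose al (F : bool -> bool -> R) :=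
  F true true - F true false - F false true + F false false.
exists (al X), (al Y), (al Z) => T WT V P.
have [h [PV trU ->]] := LE T WT V.
have trU4 := traceless_trace_free4 trU.
have -> : tdot L (tensor_act h T) =
    contract4 (entries4 L) (entries4 (tensor_act h T)).
  by rewrite /tdot sum_idx4.
rewrite (contract4_pairings _ XYZE).
have pairing F U : trace_free4 U ->
    \sum_i \sum_j F (in_plane i) (in_plane j) * U i i j j =
    al F * \sum_i \sum_j (in_plane i)%:R * (in_plane j)%:R * U i i j j.
  move=> [t12 _ _ _ [_ t34]].
  by rewrite (sum_bool_pairing in_plane F (F := fun i j => U i i j j)).
rewrite !pairing //; [|exact: trace_free4_cycle234|exact: trace_free4_swap23].
have entE : entries4 (tensor_act h T) = mxact4 (val h) (entries4 T).
  by do 4! (apply/funext => ?); rewrite entries4_act.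
congr (_ * _ + _ * _ + _ * _); rewrite -(sum_diag_mxact4 _ PV);
  apply: eq_bigr => i _; apply: eq_bigr => j _; rewrite entE //.
- by rewrite -mxact4_swap23.
- by rewrite -mxact4_cycle234.
Qed.

End StandardPlane.

(** * Integrals over the Grassmannian *)

Section GrassmannIntegral.
Local Open Scope classical_set_scope.
Variables (R : realType) (k d : nat).

Lemma mx_continuous (S : topologicalType) m n (f : S -> 'M[R]_(m, n)) :
  (forall i j, continuous (fun x => f x i j)) -> continuous f.
Proof.
move=> cf x A [P fxP PA].
have near_all : \forall y \near x, forall ij : 'I_m * 'I_n, P ij.1 ij.2 (f y ij.1 ij.2).
  by apply: filter_forall => -[i j]; exact: (cf i j x _ (fxP i j)).
by apply: filterS near_all => y h; apply: PA => i j; exact: (h (i, j)).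
Qed.

Lemma sum_continuous (S : topologicalType) I (r : seq I) (F : I -> S -> R) :
  (forall i, continuous (F i)) -> continuous (fun x => \sum_(i <- r) F i x).
Proof.
move=> cF; elim: r => [|i r IH].
  by under eq_fun do rewrite big_nil; move=> x; exact: cvg_cst.
by under eq_fun do rewrite big_cons; move=> x; apply: cvgD; [exact: cF|exact: IH].
Qed.

Lemma conj_mx_continuous (g : 'M[R]_d) :
  continuous (fun A : 'M[R]_d => g *m A *m g^T).
Proof.
apply: mx_continuous => i j.
have -> : (fun A : 'M[R]_d => (g *m A *m g^T) i j) =
    (fun A : 'M[R]_d => \sum_b \sum_a g i a * g j b * A a b).
  apply/funext => A; rewrite mxE; apply: eq_bigr => b _.
  by rewrite mxE mulr_suml; apply: eq_bigr => a _; rewrite [g^T b j]mxE mulrAC.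
apply: sum_continuous => b; apply: sum_continuous => a A.
apply: (@cvgM _ _ (nbhs A) _ (fun=> g i a * g j b) (fun B : 'M[R]_d => B a b)).
  exact: cvg_cst.
exact: coord_continuous.
Qed.

Lemma orthproj_mx_continuous : continuous (fun V : grass R k d => orthproj_mx V).
Proof. exact: initial_continuous. Qed.

Lemma gact_continuous g : continuous (Defs.gact g : grass R k d -> grass R k d).
Proof.
apply: continuous_comp_initial.
have -> : (fun V : grass R k d => orthproj_mx V) \o Defs.gact g =
    (fun A => val g *m A *m (val g)^T) \o (fun V : grass R k d => orthproj_mx V).
  by apply/funext => V /=; rewrite orthproj_mx_gact.
move=> V; apply: continuous_comp; [exact: orthproj_mx_continuous|exact: conj_mx_continuous].
Qed.

(** The diagonal entry p of a projection is the squared norm of a column, so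
    that p^2 <= p. *)
Lemma orthproj_mx_entry_le1 (V : grass R k d) i j : `|orthproj_mx V i j| <= 1.
Proof.
rewrite -(@ler_sqr R) ?nnegrE // real_normK ?num_real // expr1n.
have diagE : orthproj_mx V j j = \sum_l orthproj_mx V l j ^+ 2.
  rewrite -{1}orthproj_mx_idem mxE; apply: eq_bigr => l _.
  by rewrite -{1}orthproj_mx_sym mxE expr2.
have le_diag l : orthproj_mx V l j ^+ 2 <= orthproj_mx V j j.
  rewrite diagE (bigD1 l) //= lerDl sumr_ge0 // => m _; exact: sqr_ge0.
apply: le_trans (le_diag i) _.
have := le_diag j; set p := orthproj_mx V j j => pp.
have [//|p1] := leP p 1; exfalso.
have : p * 1 < p * p by rewrite ltr_pM2l //; lra.
by rewrite mulr1 -expr2; lra.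
Qed.

Variables (kd : (k <= d)%N) (sigma : probability (grass_borel R kd) R).

Lemma measurable_orthproj_mx i j :
  measurable_fun setT (fun W : grass_borel R kd => orthproj_mx (W : grass R k d) i j).
Proof.
apply: (measurability _ (measurable_realfun.RGenOpens.measurableE R)).
move=> _ [_ [a [b ->] <-]]; rewrite setTI; apply: sub_sigma_algebra.
have cont : continuous (fun W : grass R k d => orthproj_mx W i j).
  move=> W; apply: (@continuous_comp _ _ _ (fun W : grass R k d => orthproj_mx W)
    (fun A : 'M[R]_d => A i j)); first exact: orthproj_mx_continuous.
  exact: coord_continuous.
by move/continuousP: cont; apply; exact: interval_open.
Qed.

Lemma measurable_gact g :
  measurable_fun setT (Defs.gact g : grass_borel R kd -> grass_borel R kd).
Proof.
apply: (measurability _ (erefl : @measurable _ (grass_borel R kd) = _)).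
move=> _ [U oU <-]; rewrite setTI; apply: sub_sigma_algebra.
by have /continuousP := @gact_continuous g; apply.
Qed.

(** Bundling integrability with the value lets integrals be computed by the same
    steps as finite sums. *)
Definition has_integral (f : grass R k d -> R) (r : R) : Prop :=
  sigma.-integrable [set: grass_borel R kd] (EFin \o f) /\
  (\int[sigma]_(W in [set: grass_borel R kd]) (f W)%:E)%E = r%:E.

Lemma has_integral_cst c : has_integral (fun=> c) c.
Proof.
split; first exact: finite_measure_integrable_cst.
rewrite integral_cst // -[RHS]mule1; congr (_ * _)%E.
exact: (probability_setT sigma).
Qed.

Lemma has_integralZ c f r : has_integral f r -> has_integral (fun W => c * f W) (c * r).
Proof.
move=> [fi fE]; split.
  rewrite (_ : EFin \o _ = fun W => c%:E * (EFin \o f) W)%E //.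
  exact: integrableZl.
under eq_integral do rewrite EFinM.
by rewrite integralZl // fE.
Qed.

Lemma has_integralD f g r s : has_integral f r -> has_integral g s ->
  has_integral (fun W => f W + g W) (r + s).
Proof.
move=> [fi fE] [gi gE]; split; last by rewrite integralD_EFin // fE gE.
rewrite (_ : EFin \o _ = (EFin \o f) \+ (EFin \o g))%E //.
exact: integrableD.
Qed.

Lemma has_integral_sum I (s : seq I) (f : I -> grass R k d -> R) r :
  (forall i, has_integral (f i) (r i)) ->
  has_integral (fun W => \sum_(i <- s) f i W) (\sum_(i <- s) r i).
Proof.
move=> fr; elim: s => [|i s IH].
  by under eq_fun do rewrite big_nil; rewrite big_nil; exact: has_integral_cst.
by under eq_fun do rewrite big_cons; rewrite big_cons; exact: has_integralD.
Qed.

Lemma exists_integral (f : grass R k d -> R) :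
  measurable_fun setT (f : grass_borel R kd -> R) -> (exists M, forall W, `|f W| <= M) ->
  exists r, has_integral f r.
Proof.
move=> mf [M fM].
have fi : sigma.-integrable [set: grass_borel R kd] (EFin \o f).
  apply: measurable_bounded_integrable => //.
    by apply: (@eq_ind_r _ 1%E (fun x => x < +oo)%E) (probability_setT sigma); rewrite ltry.
  exists M; split; first exact: num_real.
  by move=> x Mx y _; apply: le_trans (fM y) (ltW Mx).
exists (fine (\int[sigma]_(W in [set: grass_borel R kd]) (f W)%:E)%E); split=> //.
by rewrite fineK // integrable_fin_num.
Qed.

Hypothesis sigma_inv : O_invariant sigma.

(** Invariance of the measure is the equality of sigma and its pushforward. *)
Lemma has_integral_gact g (f : grass R k d -> R) r r' :
  has_integral f r -> has_integral (f \o Defs.gact g) r' -> r = r'.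
Proof.
move=> [fi fE] [fgi fgE]; suff : r%:E = r'%:E by case.
rewrite -fE -fgE.
have [mf _] := integrableP _ _ _ fi.
have push := integral_pushforward (measurable_gact g) mf (D := setT) (mu := sigma).
rewrite -[RHS]push //; apply: eq_measure_integral; first exact: measurable_gact.
by move=> mphi A mA _; apply: esym; exact: sigma_inv.
Qed.

Lemma moment1_invariant (M : 'I_d -> 'I_d -> R) (g : orthogonal_group R d) :
  (forall i j, has_integral (fun W => orthproj_mx W i j) (M i j)) ->
  forall i j, mxact2 (val g) M i j = M i j.
Proof.
move=> MI i j; apply/esym; apply: (has_integral_gact (g := g) (MI i j)).
have -> : (fun W : grass R k d => orthproj_mx W i j) \o Defs.gact g =
    (fun W => mxact2 (val g) (fun a b => orthproj_mx W a b) i j).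
  apply/funext => W; rewrite /= orthproj_mx_gact mxE /mxact2 /mxact1.
  under eq_bigr do rewrite mxE mulr_suml.
  rewrite exchange_big; apply: eq_bigr => a _ /=; rewrite mulr_sumr.
  by apply: eq_bigr => b _; rewrite [(_^T) b j]mxE; ring.
apply: has_integral_sum => a; apply: has_integralZ.
by apply: has_integral_sum => b; apply: has_integralZ.
Qed.

Lemma moment2_invariant (M : 'I_d -> 'I_d -> 'I_d -> 'I_d -> R)
    (g : orthogonal_group R d) :
  (forall a b c e, has_integral (fun W => tens_sq (orthproj_mx W) a b c e) (M a b c e)) ->
  forall a b c e, mxact4 (val g) M a b c e = M a b c e.
Proof.
move=> MI a b c e; apply/esym; apply: (has_integral_gact (g := g) (MI a b c e)).
have PE (P : 'M[R]_d) i j : (val g *m P *m (val g)^T) i j =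
    mxact2 (val g) (fun a b => P a b) i j.
  rewrite mxE /mxact2 /mxact1.
  under eq_bigr do rewrite mxE mulr_suml.
  rewrite exchange_big; apply: eq_bigr => i' _ /=; rewrite mulr_sumr.
  by apply: eq_bigr => j' _; rewrite [(_^T) j' j]mxE; ring.
have -> : (fun W : grass R k d => tens_sq (orthproj_mx W) a b c e) \o Defs.gact g =
    (fun W => mxact4 (val g) (tens_sq (orthproj_mx W)) a b c e).
  apply/funext => W; rewrite /= /tens_sq orthproj_mx_gact !PE.
  rewrite /mxact4 /mxact2 /mxact1 mulr_suml; apply: eq_bigr => a' _.
  rewrite -mulrA; congr (_ * _); rewrite mulr_suml; apply: eq_bigr => b' _.
  rewrite -mulrA; congr (_ * _); rewrite mulr_sumr; apply: eq_bigr => c' _.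
  rewrite mulrCA; congr (_ * _); rewrite mulr_sumr; apply: eq_bigr => e' _.
  by rewrite mulrCA.
do 4! (apply: has_integral_sum => ?; apply: has_integralZ).
exact: MI.
Qed.

Lemma exists_moment1 i j : exists m, has_integral (fun W => orthproj_mx W i j) m.
Proof.
apply: exists_integral; first exact: measurable_orthproj_mx.
by exists 1 => W; exact: orthproj_mx_entry_le1.
Qed.

Lemma exists_moment2 a b c e :
  exists m, has_integral (fun W => tens_sq (orthproj_mx W) a b c e) m.
Proof.
apply: exists_integral.
  by apply: measurable_realfun.measurable_funM; exact: measurable_orthproj_mx.
exists 1 => W; rewrite /tens_sq normrM -[1]mulr1.
by apply: ler_pM; rewrite ?normr_ge0 ?orthproj_mx_entry_le1.
Qed.

Lemma moment1_isotropic : (2 <= d)%N -> exists m : R, forall i j,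
  has_integral (fun W => orthproj_mx W i j) (m * (i == j)%:R).
Proof.
move=> d2; have /choice[M0 M0E] : forall ij, exists m,
    has_integral (fun W => orthproj_mx W ij.1 ij.2) m.
  by move=> ij; exact: exists_moment1.
pose M i j := M0 (i, j).
have ME i j : has_integral (fun W => orthproj_mx W i j) (M i j) by exact: (M0E (i, j)).
have [||||X XE] := @isotropic2 R d unit (fun=> tt)
  (fun=> Ordinal (leq_trans (isT : 0 < 2)%N d2)) (fun=> Ordinal d2) _ _ _ M.
- by case.
- by case.
- by [].
- by move=> a b x y ab _ xy i j; exact: (moment1_invariant (refl_orth ab xy)).
by exists (X tt) => i j; rewrite -(XE i j).
Qed.

Lemma moment2_isotropic : (2 <= d)%N -> exists x y z : R, forall a b c e,
  has_integral (fun W => tens_sq (orthproj_mx W) a b c e)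
    (x * ((a == b)%:R * (c == e)%:R) + y * ((a == c)%:R * (b == e)%:R)
       + z * ((a == e)%:R * (b == c)%:R)).
Proof.
move=> d2; have /choice[M0 M0E] : forall q : 'I_d * 'I_d * 'I_d * 'I_d, exists m,
    has_integral (fun W => tens_sq (orthproj_mx W) q.1.1.1 q.1.1.2 q.1.2 q.2) m.
  by move=> q; exact: exists_moment2.
pose M a b c e := M0 (a, b, c, e).
have ME a b c e : has_integral (fun W => tens_sq (orthproj_mx W) a b c e) (M a b c e).
  exact: (M0E (a, b, c, e)).
have [||||X [Y [Z XYZ]]] := @isotropic4 R d unit (fun=> tt)
  (fun=> Ordinal (leq_trans (isT : 0 < 2)%N d2)) (fun=> Ordinal d2) _ _ _ M.
- by case.
- by case.
- by [].
- by move=> a b x y ab _ xy *; exact: (moment2_invariant (refl_orth ab xy)).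
by exists (X tt tt), (Y tt tt), (Z tt tt) => a b c e; rewrite -XYZ.
Qed.

End GrassmannIntegral.

(** * Designs, and the theorem *)

Lemma acos_le_pihalf (R : realType) (x : R) : 0 <= x <= 1 -> 0 <= acos x <= pi / 2.
Proof.
move=> /andP[x0 x1]; have x11 : -1 <= x <= 1 by apply/andP; split; lra.
have pi0 := pi_gt0 R.
rewrite acos_ge0 //= leNgt -ltr_cos ?in_itv /= ?acos_ge0 ?acos_lepi //.
  by rewrite cos_pihalf acosK -?leNgt // in_itv.
by apply/andP; split; lra.
Qed.

Section DesignAverages.
Variables (R : realType) (d : nat).
Hypothesis hd : (4 <= d)%N.
Variable sigma : probability (grass_borel R (leq2_of_leq4 hd)) R.
Hypothesis sigma_inv : O_invariant sigma.
Variables (N : nat) (V : 'I_N -> grass R 2 d).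
Hypothesis N_gt0 : (0 < N)%N.
Local Notation P i := (orthproj_mx (V i)).

(** What the averaging arguments use of a Weyl module and an intertwiner on it. *)
Definition equivariant_family n (W : set (tensor R d n))
    (Phi : tensor R d n -> grass R 2 d -> R) : Prop :=
  [/\ W 0, (forall a T U, W T -> W U -> W (a *: T + U)),
      (forall g T, W T -> W (tensor_act g T)), (forall T, W T -> traceless T) &
      (forall (a : R) T U, W T -> W U ->
         forall Z, Phi (a *: T + U) Z = a * Phi T Z + Phi U Z) /\
      (forall (g : orthogonal_group R d) T, W T ->
         forall Z, Phi (tensor_act g T) (Defs.gact g Z) = Phi T Z)].

Definition averaged (f : grass R 2 d -> R) : Prop :=
  has_integral sigma f (N%:R^-1 * \sum_i f (V i)).

Lemma averaged0 f : has_integral sigma f 0 -> \sum_i f (V i) = 0 -> averaged f.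
Proof. by rewrite /averaged => fi ->; rewrite mulr0. Qed.

(** An invariant function is constant since the action is transitive. *)
Lemma averaged_degree0 (W : set (tensor R d 0)) Phi T :
  equivariant_family W Phi -> W T -> averaged (Phi T).
Proof.
move=> [_ _ _ _ [_ Peq]] WT.
have actT g : tensor_act g T = T.
  apply/ffunP => i; rewrite ffunE (bigD1 i) //= [X in _ + X]big1 => [|j].
    by rewrite big_ord0 mul1r addr0.
  by case/eqP; apply/ffunP => - [].
have cst Z : Phi T Z = Phi T (V (Ordinal N_gt0)).
  have [g gZ] := gact_transitive (V (Ordinal N_gt0)) Z.
  by rewrite gZ -{1}(actT g) Peq.
rewrite /averaged; under eq_bigr do rewrite cst.
rewrite sumr_const card_ord -[Phi T _ *+ N]mulr_natl mulKf ?pnatr_eq0 -?lt0n //.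
have -> : Phi T = fun=> Phi T (V (Ordinal N_gt0)) by apply/funext => Z; exact: cst.
exact: has_integral_cst.
Qed.

(** The integral and the average both contract T with a multiple of the
    identity. *)
Lemma averaged_degree2 m (W : set (tensor R d 2)) Phi T :
  \sum_i P i = m *: 1%:M ->
  equivariant_family W Phi -> W T -> averaged (Phi T).
Proof.
move=> frame [W0 Wlin Wact Wtr [Plin Peq]] WT.
have [c cE] := intertwiner2 hd W0 Wlin Wact Wtr Plin Peq.
have -> : Phi T = fun Z => c * \sum_i \sum_j entries2 T i j * orthproj_mx Z i j.
  apply/funext => Z; rewrite cE //; congr (_ * _).
  by apply: eq_bigr => i _; apply: eq_bigr => j _; rewrite mulrC.
have iso0 (x : R) : \sum_i \sum_j entries2 T i j * (x * (i == j)%:R) = 0.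
  transitivity (x * \sum_i entries2 T i i); last first.
    by rewrite traceless_trace2 ?mulr0 //; exact: Wtr.
  rewrite mulr_sumr; apply: eq_bigr => i _; rewrite -(sum_delta _ i) mulr_sumr.
  by apply: eq_bigr => j _; rewrite [i == j]eq_sym; ring.
apply: averaged0.
  have [x xE] := moment1_isotropic sigma_inv (leq2_of_leq4 hd).
  suff : has_integral sigma
      (fun Z => c * \sum_i \sum_j entries2 T i j * orthproj_mx Z i j)
      (c * \sum_i \sum_j entries2 T i j * (x * (i == j)%:R)).
    by rewrite iso0 mulr0.
  apply: has_integralZ.
  by do 2! (apply: has_integral_sum => ?); apply: has_integralZ.
rewrite -mulr_sumr exchange_big /=.
rewrite (eq_bigr (fun i => \sum_j entries2 T i j * (m * (i == j)%:R))).
  by rewrite iso0 mulr0.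
move=> i _; rewrite exchange_big; apply: eq_bigr => j _ /=.
rewrite -mulr_sumr; congr (_ * _); move/matrixP/(_ i j): frame.
by rewrite summxE !mxE.
Qed.

(** The integral and the average both contract T, up to a permutation of slots,
    with a combination of the three pairings. *)
Lemma averaged_degree4 x y z (W : set (tensor R d 4)) Phi T :
  (forall a b c e, \sum_i P i a b * P i c e =
     x * ((a == b)%:R * (c == e)%:R) + y * ((a == c)%:R * (b == e)%:R)
       + z * ((a == e)%:R * (b == c)%:R)) ->
  equivariant_family W Phi -> W T -> averaged (Phi T).
Proof.
move=> moment2 [W0 Wlin Wact Wtr [Plin Peq]] WT.
have [c1 [c2 [c3 cE]]] := intertwiner4 hd W0 Wlin Wact Wtr Plin Peq.
pose C U (Z : grass R 2 d) := contract4 (tens_sq (orthproj_mx Z)) U.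
have CI U : trace_free4 U -> has_integral sigma (C U) 0.
  move=> U0; have [x' [y' [z' E]]] := moment2_isotropic sigma_inv (leq2_of_leq4 hd).
  rewrite -(contract4_isotropic (fun _ _ _ _ => erefl) U0 (x := x') (y := y') (z := z')).
  do 4! (apply: has_integral_sum => ?).
  under eq_fun do rewrite mulrC.
  by rewrite mulrC; apply: has_integralZ; exact: E.
have CS U : trace_free4 U -> \sum_i C U (V i) = 0.
  move=> U0; apply: (etrans _ (contract4_isotropic moment2 U0)).
  rewrite /C /contract4.
  do 4! (rewrite exchange_big /=; apply: eq_bigr => ? _).
  by rewrite mulr_suml.
have T0 := traceless_trace_free4 (Wtr _ WT).
have T1 := trace_free4_swap23 T0; have T2 := trace_free4_cycle234 T0.
have -> : Phi T = fun Z => c1 * C (entries4 T) Z + c2 * C (swap23 (entries4 T)) Z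
    + c3 * C (cycle234 (entries4 T)) Z by apply/funext => Z; exact: cE.
apply: averaged0; last first.
  by rewrite !big_split /= -!mulr_sumr !CS // !mulr0 !addr0.
have -> : 0 = c1 * 0 + c2 * 0 + c3 * 0 by rewrite !mulr0 !addr0.
apply: has_integralD; first (apply: has_integralD);
  by apply: has_integralZ; exact: CI.
Qed.

Lemma weyl_equivariant_family (lambda : seq nat)
    (Phi : tensor R d (sumn lambda) -> grass R 2 d -> R) :
  is_intertwiner Phi -> equivariant_family (@weyl_module R d lambda) Phi.
Proof.
move=> [Plin Peq _]; split; last by split.
- exact: weyl_module0.
- by move=> a T U; exact: weyl_module_linear.
- by move=> g T; exact: weyl_module_act.
- by move=> T [].
Qed.

(** The partitions of degree at most two are the empty one, (1), (2) and (1, 1); the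
    last two both lead to tensors of order four. *)
Lemma averaged_Hcomp m x y z (mu : seq nat) (h : grass R 2 d -> R) :
  \sum_i P i = m *: 1%:M ->
  (forall a b c e, \sum_i P i a b * P i c e =
     x * ((a == b)%:R * (c == e)%:R) + y * ((a == c)%:R * (b == e)%:R)
       + z * ((a == e)%:R * (b == c)%:R)) ->
  is_partition mu -> (size mu <= 2)%N -> (sumn mu <= 2)%N -> Hcomp mu h ->
  averaged h.
Proof.
move=> frame moment2 part _ mu2 [Phi /weyl_equivariant_family PhiE [T WT ->]].
case: mu part mu2 Phi PhiE T WT => [|m1 [|m2 [|m3 mu]]] /=.
- by move=> _ _ Phi PhiE T WT; exact: (averaged_degree0 PhiE WT).
- case: m1 => [|[|[|m1]]] // _ _ Phi PhiE T WT.
    exact: (@averaged_degree2 m _ Phi T frame PhiE WT).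
  exact: (@averaged_degree4 x y z _ Phi T moment2 PhiE WT).
- move=> /andP[_ h0] sum2; have [-> ->] : m1 = 1%N /\ m2 = 1%N.
    move: h0 sum2; rewrite !in_cons !negb_or.
    by move=> /and3P[p1 p2 _]; lia.
  move=> Phi PhiE T WT.
  exact: (@averaged_degree4 x y z _ Phi T moment2 PhiE WT).
move=> /andP[_ h0] sum2; exfalso; move: h0 sum2.
by rewrite !in_cons !negb_or => /and4P[p1 p2 p3 _]; lia.
Qed.

Lemma averaged_Pol2 m x y z f :
  \sum_i P i = m *: 1%:M ->
  (forall a b c e, \sum_i P i a b * P i c e =
     x * ((a == b)%:R * (c == e)%:R) + y * ((a == c)%:R * (b == e)%:R)
       + z * ((a == e)%:R * (b == c)%:R)) ->
  Pol2 2 f -> averaged f.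
Proof.
move=> frame moment2 [l [mu [h [hP fE]]]].
have -> : f = fun Z => \sum_j h j Z by apply/funext.
rewrite /averaged exchange_big /= mulr_sumr; apply: has_integral_sum => j.
have [part size2 sum2 hj] := hP j.
exact: (averaged_Hcomp frame moment2 part size2 sum2 hj).
Qed.

End DesignAverages.

Theorem theorem5p6 (R : realType) (d : nat) (hd : (4 <= d)%N)
    (N : nat) (V : 'I_N -> grass R 2 d) (V_inj : injective V)
    (V_ectff : ECTFF 2 V) :
  [/\ d%:R ^+ 2 / 4 <= N%:R :> R,
      (N <= 'C(d.+1, 2))%N,
      N%:R = d%:R ^+ 2 / 4 :> R <-> EITFF 2 V
    & forall sigma : probability (grass_borel R (leq2_of_leq4 hd)) R,
        O_invariant sigma ->
        (N = 'C(d.+1, 2) <-> tight_grassmann_4design sigma V)].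
Proof.
have [[c chord] [A A0 tight]] := V_ectff.
pose s : R := 2 - c ^+ 2.
have equi i j : i != j -> \tr (orthproj_mx (V i) *m orthproj_mx (V j)) = s.
  by move=> ij; have := chordal_dist_sqr (V i) (V j); rewrite chord // /s => ->; ring.
have N4 : (4 <= N)%N by rewrite -(ler_nat R); exact: (frame_size_ge4 tight equi A0 hd).
have s2 : s < 2.
  have i0 : (0 < N)%N by exact: leq_trans N4.
  have i1 : (1 < N)%N by exact: leq_trans N4.
  by rewrite -(equi (Ordinal i0) (Ordinal i1) isT); apply: tr2_lt2.
split.
- exact: (frame_lower_bound tight equi A0 hd).
- exact: (equichordal_upper_bound equi s2).
- split=> [/(frame_lower_eq tight equi A0 hd) iso|[[theta _ iso] _]].
    split; last by exists A.
    exists (acos (Num.sqrt (s / 2))).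
      apply: acos_le_pihalf; rewrite sqrtr_ge0 /= -[X in _ <= X]sqrtr1.
      by rewrite ler_wsqrtr //; lra.
    move=> i j ij l.
    have [a [b [Ea Eb /andP[b0 ba] a1 [ab _]]]] := slackE equi ij.
    have abE : a = b by rewrite -Ea -Eb; exact: iso.
    have -> : principal_angle (V i) (V j) l = acos a.
      rewrite /principal_angle; case: l => [[|[|//]] l2].
        by rewrite -Ea; congr (acos (_ _)); apply/val_inj.
      by rewrite abE -Eb; congr (acos (_ _)); apply/val_inj.
    congr acos; rewrite -ab -abE.
    have -> : (a ^+ 2 + a ^+ 2) / 2 = a ^+ 2 by field.
    by rewrite sqrtr_sqr ger0_norm // (le_trans b0).
  apply/(frame_lower_eq tight equi A0 hd) => i j ij.
  have [a [b [Ea Eb /andP[b0 ba] a1 _]]] := slackE equi ij.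
  have := iso i j ij 0; rewrite -(iso i j ij 1) /principal_angle Ea Eb.
  move=> /(congr1 cos); rewrite !acosK // in_itv /=; apply/andP; split; lra.
move=> sigma sigma_inv; split=> [NE|[_ //]]; split=> // f Pf.
have frame := frame_sum tight.
have moment2 := frame_second_moment equi s2 frame NE.
have [] // := averaged_Pol2 sigma_inv (leq_trans (isT : 0 < 4)%N N4) frame
  (x := s * (A * (d%:R + 2) / 4) / 2) (y := (2 - s) / 2) (z := (2 - s) / 2) _ Pf.
by move=> a b c' e; rewrite moment2; ring.
Qed.
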